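(* The asymptotic behavior of $c_{2n}$ for large $n$ is given by $$c_{2n}=\left(1+O\left(n^{-1/10}\right)\right)16\sqrt2\,\pi^{3/2}\sqrt n\,\exp\left(-4\sqrt{\pi n}\right)$$ as $n\to\infty$.
   Context: For $x>0$ let $\omega(x)=\sum_{m=1}^\infty(2\pi^2m^4x^2-3\pi m^2x)e^{-\pi m^2x}$. For $n\ge0$ define $$c_n=2\sqrt2\int_0^\infty\frac{\omega(x)}{(x+1)^{3/2}}\left(\frac{x-1}{x+1}\right)^n\,dx$$ (an absolutely convergent integral). *)

(* Defs.v *)
From HB Require Import structures.
From mathcomp Require Import all_boot all_order all_algebra.
From mathcomp Require Import all_classical all_reals all_analysis.

Set Implicit Arguments.
Unset Strict Implicit.
Unset Printing Implicit Defensive.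

Import Order.TTheory GRing.Theory Num.Theory.
Import numFieldNormedType.Exports.

Local Open Scope classical_set_scope.
Local Open Scope ring_scope.

Definition omega (R : realType) (x : R) : R :=
  \big[+%R/0]_(1 <= m <oo)
    ((2 * pi ^+ 2 * m%:R ^+ 4 * x ^+ 2 - 3 * pi * m%:R ^+ 2 * x)
      * expR (- (pi * m%:R ^+ 2 * x))).

(* The integral is a Lebesgue integral: the absolutely convergent improper
   integral of the source. *)
Definition coef_c (R : realType) (n : nat) : R :=
  2 * Num.sqrt 2 *
  \int[lebesgue_measure]_(x in `]0%R, +oo[)
    (omega x / (x + 1) `^ (3 / 2) * ((x - 1) / (x + 1)) ^+ n).

(* Main.v *)
Require Import Defs.
From HB Require Import structures.
From mathcomp Require Import all_boot all_order all_algebra.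
From mathcomp Require Import all_classical all_reals all_analysis measurable_realfun.
From mathcomp Require Import ring lra zify.

(** Let omega_term x u be the summand of omega at x, regarded as a function of a
    real variable u, so that omega x is the sum of omega_term x m over m >= 1.

    The cosine transform of omega_term x is, up to the factor 1 / (2 sqrt x),
    omega_term (1/x): the Gaussian moments of orders 2 and 4 are combined in
    exactly the way that makes the function self-dual. Since omega_term x
    vanishes at 0, Poisson summation gives omega x = x^(-1/2) omega (1/x)
    (omega_inv), and the integrand W of the even coefficient c_(2n) satisfies
    W x = x^(-2) W (1/x) (coef_integrand_inv). The two halves ]0, 1] and
    [1, +oo[ thus contribute equally, and on [1, +oo[ the first term of the
    series carries everything but a fraction O(e^(- pi x)).

    For large x one has ((x-1)/(x+1))^(2n) ~ e^(-4n/x),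
    (x+1)^(-3/2) ~ x^(-3/2) and omega x ~ 2 pi^2 x^2 e^(- pi x), whence
    W x ~ 2 pi^2 sqrt x e^(- (pi x + 4n/x)). This concentrates around
    x = 2 sqrt (n/pi). The relative errors made are at most of the orders 1/x
    and n/x^3, hence n^(-1/2) at the saddle point, which is smaller than the
    n^(-1/10) that is claimed.

    Laplace's method is avoided: the integrals over ]0, +oo[ of
    sqrt x x^(-j) e^(- (a x + b/x)) are Bessel functions of half-integral order,
    and elementary (bessel_ker0_integral to bessel_ker3_integral). So W is
    enclosed, for x >= 1, between two combinations L and U of such kernels
    (coef_integrand_ge, coef_integrand_le). As the symmetry of W also exchanges
    such kernels with each other, L x + x^(-2) L (1/x) and
    U x + x^(-2) U (1/x) enclose W on the whole of ]0, +oo[; this works because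
    L <= 0 <= U on ]0, 1]. Both envelopes have explicit integrals, whose
    leading terms agree: after multiplication by 2 sqrt 2 they are
    2 sqrt 2 * 2 * 2 pi^2 * sqrt pi e^(-4 sqrt (pi n)) * 2 sqrt n / pi.

    Poisson summation on the half-line (half_line_poisson) is obtained from the
    nonnegative trigonometric polynomials cos^(2N) (pi u), divided by their mean
    C(2N, N) / 4^N. Integrated against a decaying Lipschitz function f they
    tend to f 0 / 2 + f 1 + f 2 + ..., because their mass concentrates at the
    integers; expanded into cosines they give the values F k of the cosine
    transform weighted by C(2N, N+k) / C(2N, N), and these weights tend to 1. *)

Set Implicit Arguments.
Unset Strict Implicit.
Unset Printing Implicit Defensive.

Import Order.TTheory GRing.Theory Num.Theory.
Import numFieldNormedType.Exports.

Local Open Scope classical_set_scope.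
Local Open Scope ring_scope.

(** * Half-line integrals through antiderivatives *)
Section HalfLineFTC.
Variable R : realType.
Notation mu := (@lebesgue_measure R).

Lemma is_derive1_inv (x : R) : 0 < x ->
  is_derive x 1 (@GRing.inv R) (- (x ^- 2)).
Proof.
move=> x0; have xn0 : id x != 0 by rewrite gt_eqF.
have := is_deriveV xn0 (is_derive_id x 1).
by rewrite /GRing.scale /= mulr1.
Qed.

Lemma is_derive_continuous (f : R -> R) (x df : R) :
  is_derive x 1 f df -> {for x, continuous f}.
Proof.
by move=> [df1 _]; apply/differentiable_continuous/derivable1_diffP.
Qed.

Lemma is_derive_exprn (f : R -> R) n (x df : R) : is_derive x 1 f df ->
  is_derive x 1 (fun y => f y ^+ n) (n%:R * f x ^+ n.-1 * df).
Proof. by move=> d; have := is_deriveX n d; rewrite exprfctE. Qed.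

Lemma expRN_le_exprV (n : nat) (y : R) : 0 < y ->
  expR (- y) <= n.+1`!%:R * y^-1 ^+ n.+1.
Proof.
move=> y0; rewrite expRN -[leRHS]invrK lef_pV2; last 2 first.
- by rewrite posrE expR_gt0.
- by rewrite posrE invr_gt0 mulr_gt0 ?exprn_gt0 ?invr_gt0// ltr0n fact_gt0.
have := expR_ge1Dxn n (ltW y0); apply: le_trans.
by rewrite invfM -exprVn invrK mulrC lerDr.
Qed.

(** The fundamental theorem of calculus for half-lines asks for continuity at the
    finite endpoint. A kernel such as e^(-b/x) is flat at 0 but given there by a
    formula with the junk value of 1/0; replacing f and F at 0 by their limits
    repairs this. *)
Lemma ge0_FTC_oo (f F : R -> R) (l0 l1 : R) :
  (forall x : R, 0 < x -> 0 <= f x) ->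
  (forall x : R, 0 < x -> {for x, continuous f}) ->
  f x @[x --> (0:R)^'+] --> 0 ->
  (forall x : R, 0 < x -> is_derive x 1 F (f x)) ->
  F x @[x --> (0:R)^'+] --> l0 -> F x @[x --> +oo] --> l1 ->
  mu.-integrable `]0, +oo[ (EFin \o f) /\
  \int[mu]_(x in `]0, +oo[) f x = l1 - l0.
Proof.
move=> f0 cf fl dF Fl0 Fl1.
have mf : measurable_fun (`]0, +oo[ : set R) f.
  apply: open_continuous_measurable_fun => //.
  by move=> x /set_mem; rewrite /= in_itv/= andbT; exact: cf.
pose g (x : R) := if 0 < x then f x else 0.
pose G (x : R) := if 0 < x then F x else l0.
have near_gt (x : R) : 0 < x -> \forall y \near x, 0 < y.
  by move=> x0; exact: lt_nbhsr.
have gnear (x : R) : 0 < x -> \near x, f x = g x.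
  by move=> /near_gt; apply: filterS => y y0; rewrite /g y0.
have Gnear (x : R) : 0 < x -> \near x, F x = G x.
  by move=> /near_gt; apply: filterS => y y0; rewrite /G y0.
have dG (x : R) : 0 < x -> is_derive x 1 G (f x).
  by move=> x0; apply: near_eq_is_derive (dF _ x0); exact: Gnear.
have I : (\int[mu]_(x in `[0%R, +oo[) (g x)%:E = l1%:E - (G 0)%:E)%E.
  apply: ge0_continuous_FTC2y.
  - by move=> x _; rewrite /g; case: ifPn => // /f0.
  - apply/continuous_within_itvcyP; split.
      move=> x; rewrite in_itv/= andbT => x0.
      have := cf _ x0; rewrite /continuous_at -(nbhs_singleton (gnear _ x0)).
      by apply: cvg_trans; apply: near_eq_cvg; exact: gnear.
    rewrite {2}/g ltxx; apply: cvg_trans fl; apply: near_eq_cvg.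
    by near=> y; rewrite /g; have -> : 0 < y by [].
  - apply: cvg_trans Fl1; apply: near_eq_cvg.
    by near=> y; rewrite /G; have -> : 0 < y by [].
  - by move=> x x0; have [] := dG x x0.
  - rewrite {2}/G ltxx; apply: cvg_trans Fl0; apply: near_eq_cvg.
    by near=> y; rewrite /G; have -> : 0 < y by [].
  - move=> x; rewrite in_itv/= andbT => x0.
    by rewrite derive1E (@derive_val _ _ _ _ _ _ _ (dG x x0)) /g x0.
have {}I : (\int[mu]_(x in `]0%R, +oo[) (f x)%:E = (l1 - l0)%:E)%E.
  transitivity (\int[mu]_(x in `]0%R, +oo[) (g x)%:E)%E.
    apply: eq_integral => x /set_mem; rewrite /= in_itv/= andbT => x0.
    by rewrite /g x0.
  rewrite integral_itv_obnd_cbnd; last first.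
    apply/measurable_EFinP; apply: eq_measurable_fun mf => x /set_mem.
    by rewrite /= in_itv/= andbT /g => ->.
  by rewrite I /G ltxx.
split; last by rewrite /Rintegral I.
apply/integrableP; split; first exact/measurable_EFinP.
apply: (@le_lt_trans _ _ (\int[mu]_(x in `]0%R, +oo[) (f x)%:E)%E); last first.
  by rewrite I ltry.
rewrite le_eqVlt; apply/orP; left; apply/eqP; apply: eq_integral => x /set_mem.
by rewrite /= in_itv/= andbT => x0; rewrite ger0_norm // f0.
Unshelve. all: by end_near. Qed.

End HalfLineFTC.

(** * The primitive of the Gaussian *)

Section GaussPrimitive.
Variable R : realType.
Notation mu := (@lebesgue_measure R).

Let gprim (v : R) := \int[mu]_(t in `]-oo, v]) gauss_fun t.

Let dgprim (v : R) : is_derive v 1 gprim (gauss_fun v).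
Proof.
have [] := @continuous_FTC1 R gauss_fun -oo%O v (v + 1).
- by rewrite ltrDl.
- by apply: (@integrableS _ _ _ _ setT) => //; exact: integrableT_gauss.
- exact: ltNyr.
- exact: continuous_gauss_fun.
by rewrite derive1E => d1 d2; exact: DeriveDef d1 d2.
Qed.

Definition gauss_prim (v : R) := gprim v - gprim 0.

Global Instance is_derive_gauss_prim (v : R) :
  is_derive v 1 gauss_prim (expR (- v ^+ 2)).
Proof.
have := dgprim v => d.
by apply: trigger_derive; rewrite subr0.
Qed.

Lemma gauss_primN v : gauss_prim (- v) = - gauss_prim v.
Proof.
apply/eqP; rewrite -subr_eq0 opprK; apply/eqP.
suff d (x : R) : is_derive x 1 (fun v => gauss_prim (- v) + gauss_prim v) 0.
  have := is_derive_0_is_cst v 0 d; rewrite oppr0 => ->.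
  by rewrite /gauss_prim subrr addr0.
have h : is_derive x 1 (gauss_prim \o -%R) (expR (- (- x) ^+2) * (-1)).
  exact: is_derive1_comp.
have {}h : is_derive x 1 (fun v => gauss_prim (- v))
  (expR (- (- x) ^+2) * (-1)) := h.
apply: trigger_derive.
by rewrite sqrrN mulrN mulr1 addNr.
Qed.

Lemma cvg_gauss_prim_pinfty : gauss_prim v @[v --> +oo] --> Num.sqrt pi / 2.
Proof.
have cvg_Ig : @gauss_integral_proof.integral0_gauss R x @[x --> +oo] --> Num.sqrt pi / 2.
  (* the known limit is that of the square, pi / 4 *)
  have : Num.sqrt (@gauss_integral_proof.integral0_gauss R x ^+ 2) @[x --> +oo]
      --> Num.sqrt (pi / 4).
    apply: continuous_cvg => //;
      [exact: sqrt_continuous|exact: gauss_integral_proof.cvg_integral0_gauss_sqr].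
  have -> : Num.sqrt (pi / 4 : R) = Num.sqrt pi / 2.
    rewrite sqrtrM ?pi_ge0// sqrtrV// (_ : 4 = 2 ^+ 2); last by ring.
    by rewrite sqrtr_sqr ger0_norm.
  rewrite (_ : (fun _ => Num.sqrt _) = @gauss_integral_proof.integral0_gauss R)//.
  apply/funext => r; rewrite sqrtr_sqr// ger0_norm//.
  exact: gauss_integral_proof.integral0_gauss_ge0.
apply: cvg_trans cvg_Ig; apply: near_eq_cvg; near=> x.
have x0 : 0 <= x by [].
rewrite /gauss_integral_proof.integral0_gauss /gauss_prim /gprim.
have ig (A : set R) : measurable A -> mu.-integrable A (EFin \o gauss_fun).
  by move=> mA; apply: (@integrableS _ _ _ _ setT) => //; exact: integrableT_gauss.
rewrite Rintegral_itvB ?bnd_simp//; last exact: ig.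
by rewrite Rintegral_itv_obnd_cbnd//; exact: ig.
Unshelve. all: by end_near. Qed.

Lemma cvg_gauss_prim_ninfty : gauss_prim v @[v --> -oo] --> - (Num.sqrt pi / 2).
Proof.
apply/cvgNy_compNP.
rewrite (_ : _ \o _ = fun v => - gauss_prim v); last first.
  by apply/funext => v /=; rewrite gauss_primN.
by apply: cvgN; exact: cvg_gauss_prim_pinfty.
Qed.

End GaussPrimitive.

(** * Bessel integrals of half-integral order *)

Section BesselIntegrals.
Variable R : realType.
Notation mu := (@lebesgue_measure R).

Definition bessel_ker (j : nat) (a b x : R) :=
  Num.sqrt x * x^-1 ^+ j * expR (- (a * x + b / x)).

Section fixed_parameters.
Variables a b : R.
Hypotheses (a0 : 0 < a) (b0 : 0 < b).
Local Notation K j := (bessel_ker j a b).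
Let sa := Num.sqrt a.
Let sb := Num.sqrt b.
Let c := 2 * (sa * sb).

Let sa0 : 0 < sa. Proof. by rewrite sqrtr_gt0. Qed.
Let sb0 : 0 < sb. Proof. by rewrite sqrtr_gt0. Qed.
Let saE : a = sa ^+ 2. Proof. by rewrite sqr_sqrtr// ltW. Qed.
Let sbE : b = sb ^+ 2. Proof. by rewrite sqr_sqrtr// ltW. Qed.

Lemma bessel_ker_ge0 j x : 0 < x -> 0 <= K j x.
Proof.
by move=> x0; rewrite !mulr_ge0 ?sqrtr_ge0 ?expR_ge0 ?exprn_ge0 ?invr_ge0 ?ltW.
Qed.

Lemma bessel_ker_continuous j x : 0 < x -> {for x, continuous (K j)}.
Proof.
move=> x0; have di := is_derive1_inv x0; have ds := is_derive1_sqrt x0.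
have dj := is_derive_exprn j di.
by rewrite /bessel_ker; exact: is_derive_continuous.
Qed.

Lemma bessel_ker_le_near0 j x : 0 < x -> x <= 1 ->
  K j x <= j.+1`!%:R / b ^+ j.+1 * x.
Proof.
move=> x0 x1.
have s1 : Num.sqrt x <= 1 by rewrite -sqrtr1 ler_sqrt.
have y0 : 0 < b / x by rewrite divr_gt0.
have f0 : 0 < j.+1`!%:R :> R by rewrite ltr0n fact_gt0.
have e1 : expR (- (a * x + b / x)) <= j.+1`!%:R * (x / b) ^+ j.+1.
  apply: (@le_trans _ _ (expR (- (b / x)))).
    by rewrite ler_expR lerN2 lerDr mulr_ge0 ?ltW.
  by have := expRN_le_exprV j y0; rewrite invf_div.
rewrite /bessel_ker.
apply: (@le_trans _ _ (1 * x^-1 ^+ j * (j.+1`!%:R * (x / b) ^+ j.+1))).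
  rewrite ler_pM ?mulr_ge0 ?sqrtr_ge0 ?expR_ge0 ?exprn_ge0 ?invr_ge0 ?(ltW x0)//.
  by rewrite ler_pM ?sqrtr_ge0 ?exprn_ge0 ?invr_ge0 ?(ltW x0).
rewrite mul1r le_eqVlt; apply/orP; left; apply/eqP.
rewrite expr_div_n exprVn (exprS x).
have xj : x ^+ j != 0 by rewrite expf_neq0// gt_eqF.
have bj : b ^+ j.+1 != 0 by rewrite expf_neq0// gt_eqF.
by field; rewrite xj bj.
Qed.

Lemma bessel_ker_le_neary j x : 1 <= x -> K j x <= 2 / a ^+ 2 / x.
Proof.
move=> x1; have x0 : 0 < x by apply: lt_le_trans x1.
have y0 : 0 < a * x by rewrite mulr_gt0.
have s1 : Num.sqrt x <= x.
  have s1 : 1 <= Num.sqrt x by rewrite -[leLHS]sqrtr1 ler_sqrt ?(ltW x0).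
  by rewrite -[X in _ <= X](sqr_sqrtr (ltW x0)) expr2 ler_peMr ?sqrtr_ge0.
have e1 : expR (- (a * x + b / x)) <= 2 / (a * x) ^+ 2.
  apply: (@le_trans _ _ (expR (- (a * x)))).
    by rewrite ler_expR lerN2 lerDl divr_ge0 ?ltW.
  by have := expRN_le_exprV 1 y0; rewrite exprVn.
apply: (@le_trans _ _ (x * 1 * (2 / (a * x) ^+ 2))).
  rewrite ler_pM ?mulr_ge0 ?sqrtr_ge0 ?expR_ge0 ?exprn_ge0 ?invr_ge0 ?(ltW x0)//.
  rewrite ler_pM ?sqrtr_ge0 ?exprn_ge0 ?invr_ge0 ?(ltW x0)//.
  by rewrite exprn_ile1 ?invr_ge0 ?(ltW x0)// invf_le1.
rewrite mulr1 le_eqVlt; apply/orP; left; apply/eqP.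
by field; rewrite !gt_eqF.
Qed.

Lemma bessel_ker_cvg0 j : K j x @[x --> (0:R)^'+] --> (0 : R).
Proof.
apply: (@squeeze_cvgr _ _ _ _ (cst 0) (fun x => j.+1`!%:R / b ^+ j.+1 * x)).
- near=> x; rewrite /= bessel_ker_ge0 //= bessel_ker_le_near0//.
  by near: x; apply: nbhs_right_le; exact: ltr01.
- exact: cvg_cst.
- rewrite -[X in _ --> X](mulr0 (j.+1`!%:R / b ^+ j.+1)).
  by apply: cvgMr; apply: cvg_at_right_filter; exact: cvg_id.
Unshelve. all: by end_near. Qed.

Lemma bessel_ker_cvgy j : K j x @[x --> +oo] --> (0 : R).
Proof.
apply: (@squeeze_cvgr _ _ _ _ (cst 0) (fun x => 2 / a ^+ 2 / x)).
- near=> x; rewrite /= bessel_ker_ge0 //= bessel_ker_le_neary//.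
- exact: cvg_cst.
- rewrite -[X in _ --> X](mulr0 (2 / a ^+ 2)).
  apply: cvgMr; apply/gtr0_cvgV0; last exact: cvg_id.
  by near=> x.
Unshelve. all: by end_near. Qed.

(** The two complete squares hidden in the exponent:
    a x + b/x = um^2 + c = up^2 - c with um, up = sqrt (a x) -+ sqrt (b/x).
    As um' and up' are combinations of x^(-1/2) and x^(-3/2), the derivatives of
    gauss_prim um and gauss_prim up span the kernels of index 1 and 2. *)
Let um (x : R) := sa * Num.sqrt x - sb * (Num.sqrt x * x^-1).
Let up (x : R) := sa * Num.sqrt x + sb * (Num.sqrt x * x^-1).

Let cvg_sqrty : @Num.sqrt R x @[x --> +oo] --> +oo.
Proof.
apply/cvgryPge => A; near=> x.
have A0 : `|A| ^+ 2 <= x by [].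
apply: (le_trans (ler_norm _)); rewrite -[leLHS]ger0_norm// -sqrtr_sqr.
by rewrite ler_sqrt// (le_trans _ A0)// sqr_ge0.
Unshelve. all: by end_near. Qed.

Let sqrtV (x : R) : 0 < x -> Num.sqrt x * x^-1 = (Num.sqrt x)^-1.
Proof.
move=> x0; rewrite -{2}[x]sqr_sqrtr ?ltW//.
by field; rewrite gt_eqF// sqrtr_gt0.
Qed.

Let cvg_sqrtV0 : Num.sqrt x * x^-1 @[x --> (0:R)^'+] --> +oo.
Proof.
apply/cvgryPge => A; near=> x.
have x0 : 0 < x by [].
have xA : x <= (`|A| + 1) ^- 2 by near: x; apply: nbhs_right_le; rewrite invr_gt0 exprn_gt0// ltr_wpDl.
rewrite sqrtV//; apply: (@le_trans _ _ (`|A| + 1)); first by rewrite (le_trans (ler_norm A))// lerDl.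
rewrite -[leLHS]invrK lef_pV2 ?posrE ?sqrtr_gt0 ?invr_gt0 ?ltr_wpDl//.
rewrite -[leRHS]ger0_norm ?invr_ge0 ?addr_ge0// -sqrtr_sqr ler_sqrt ?exprVn//.
Unshelve. all: by end_near. Qed.

Let um_cvgy : um x @[x --> +oo] --> +oo.
Proof.
apply/cvgryPge => A; near=> x.
have x1 : 1 <= x by [].
have x0 : 0 < x by exact: lt_le_trans x1.
have xA : (A + sb) / sa <= Num.sqrt x.
  by near: x; move/cvgryPge : cvg_sqrty; apply.
have : (A + sb) <= sa * Num.sqrt x by rewrite mulrC -ler_pdivrMr.
have : sb * (Num.sqrt x * x^-1) <= sb.
  rewrite ler_piMr ?(ltW sb0)// sqrtV// invf_le1 ?sqrtr_gt0//.
  by rewrite -[leLHS]sqrtr1 ler_sqrt ?(ltW x0).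
rewrite /um; lra.
Unshelve. all: by end_near. Qed.

Let up_cvgy : up x @[x --> +oo] --> +oo.
Proof.
apply/cvgryPge => A; near=> x.
have x0 : 0 < x by [].
have xA : A / sa <= Num.sqrt x by near: x; move/cvgryPge : cvg_sqrty; apply.
have : A <= sa * Num.sqrt x by rewrite mulrC -ler_pdivrMr.
have : 0 <= sb * (Num.sqrt x * x^-1).
  by rewrite !mulr_ge0 ?sqrtr_ge0 ?invr_ge0 ?ltW.
rewrite /up; lra.
Unshelve. all: by end_near. Qed.

Let up_cvg0 : up x @[x --> (0:R)^'+] --> +oo.
Proof.
apply/cvgryPge => A; near=> x.
have x0 : 0 < x by [].
have xA : A / sb <= Num.sqrt x * x^-1 by near: x; move/cvgryPge : cvg_sqrtV0; apply.
have : A <= sb * (Num.sqrt x * x^-1) by rewrite mulrC -ler_pdivrMr.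
have : 0 <= sa * (Num.sqrt x) by rewrite !mulr_ge0 ?sqrtr_ge0 ?ltW.
rewrite /up; lra.
Unshelve. all: by end_near. Qed.

Let um_cvg0 : um x @[x --> (0:R)^'+] --> -oo.
Proof.
apply/cvgrNyPle => A; near=> x.
have x0 : 0 < x by [].
have x1 : x <= 1 by near: x; apply: nbhs_right_le; exact: ltr01.
have xA : (sa - A) / sb <= Num.sqrt x * x^-1 by near: x; move/cvgryPge : cvg_sqrtV0; apply.
have : sa - A <= sb * (Num.sqrt x * x^-1) by rewrite mulrC -ler_pdivrMr.
have : sa * (Num.sqrt x) <= sa.
  by rewrite ler_piMr ?(ltW sa0)// -[leRHS]sqrtr1 ler_sqrt.
rewrite /um; lra.
Unshelve. all: by end_near. Qed.

Let E := expR (- c).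

Let A1 (x : R) := sa^-1 * (E * gauss_prim (um x) + E^-1 * gauss_prim (up x)).
Let A2 (x : R) := sb^-1 * (E * gauss_prim (um x) - E^-1 * gauss_prim (up x)).

Let sqE (x : R) : 0 < x -> x = Num.sqrt x ^+ 2.
Proof. by move=> x0; rewrite sqr_sqrtr// ltW. Qed.

Let dum (x : R) : 0 < x -> is_derive x 1 um
  (sa * (Num.sqrt x * x^-1) / 2 + sb * (Num.sqrt x * x^-1 ^+ 2) / 2).
Proof.
move=> x0; have di := is_derive1_inv x0; have ds := is_derive1_sqrt x0.
apply: trigger_derive; rewrite /GRing.scale /=.
have s0 : Num.sqrt x != 0 by rewrite gt_eqF// sqrtr_gt0.
have xx := sqE x0; set s := Num.sqrt x in xx s0 *; rewrite xx.
by field.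
Qed.

Let dup (x : R) : 0 < x -> is_derive x 1 up
  (sa * (Num.sqrt x * x^-1) / 2 - sb * (Num.sqrt x * x^-1 ^+ 2) / 2).
Proof.
move=> x0; have di := is_derive1_inv x0; have ds := is_derive1_sqrt x0.
apply: trigger_derive; rewrite /GRing.scale /=.
have s0 : Num.sqrt x != 0 by rewrite gt_eqF// sqrtr_gt0.
have xx := sqE x0; set s := Num.sqrt x in xx s0 *; rewrite xx.
by field.
Qed.

Let um2 (x : R) : 0 < x -> expR (- um x ^+ 2) = expR (- (a * x + b / x)) * E^-1.
Proof.
move=> x0; rewrite -expRN -expRD; congr expR.
have s0 : Num.sqrt x != 0 by rewrite gt_eqF// sqrtr_gt0.
rewrite /um /c {1}saE {1}sbE.
have xx := sqE x0; set s := Num.sqrt x in xx s0 *; rewrite xx.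
by field.
Qed.

Let up2 (x : R) : 0 < x -> expR (- up x ^+ 2) = expR (- (a * x + b / x)) * E.
Proof.
move=> x0; rewrite -expRD; congr expR.
have s0 : Num.sqrt x != 0 by rewrite gt_eqF// sqrtr_gt0.
rewrite /up /c {1}saE {1}sbE.
have xx := sqE x0; set s := Num.sqrt x in xx s0 *; rewrite xx.
by field.
Qed.

Let E0 : E != 0. Proof. by rewrite gt_eqF// expR_gt0. Qed.

Let dgum (x : R) : 0 < x -> is_derive x 1 (fun x => gauss_prim (um x))
  (expR (- (a * x + b / x)) * E^-1 *
  (sa * (Num.sqrt x * x^-1) / 2 + sb * (Num.sqrt x * x^-1 ^+ 2) / 2)).
Proof. by move=> x0; rewrite -um2//; have d := dum x0; exact: is_derive1_comp. Qed.

Let dgup (x : R) : 0 < x -> is_derive x 1 (fun x => gauss_prim (up x))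
  (expR (- (a * x + b / x)) * E *
  (sa * (Num.sqrt x * x^-1) / 2 - sb * (Num.sqrt x * x^-1 ^+ 2) / 2)).
Proof. by move=> x0; rewrite -up2//; have d := dup x0; exact: is_derive1_comp. Qed.

Let dA1 (x : R) : 0 < x -> is_derive x 1 A1 (K 1 x).
Proof.
move=> x0; have d1 := dgum x0; have d2 := dgup x0.
apply: trigger_derive; rewrite /GRing.scale /= /bessel_ker.
by field; rewrite E0 !gt_eqF.
Qed.

Let dA2 (x : R) : 0 < x -> is_derive x 1 A2 (K 2 x).
Proof.
move=> x0; have d1 := dgum x0; have d2 := dgup x0.
apply: trigger_derive; rewrite /GRing.scale /= /bessel_ker.
by field; rewrite E0 !gt_eqF.
Qed.

Let p2 : R := Num.sqrt pi / 2.

Let A1_cvgy : A1 x @[x --> +oo] --> sa^-1 * (E * p2 + E^-1 * p2).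
Proof.
apply: cvgMr; apply: cvgD; apply: cvgMr.
  by apply: cvg_comp um_cvgy _; exact: cvg_gauss_prim_pinfty.
by apply: cvg_comp up_cvgy _; exact: cvg_gauss_prim_pinfty.
Qed.

Let A1_cvg0 : A1 x @[x --> (0:R)^'+] --> sa^-1 * (E * - p2 + E^-1 * p2).
Proof.
apply: cvgMr; apply: cvgD; apply: cvgMr.
  by apply: cvg_comp um_cvg0 _; exact: cvg_gauss_prim_ninfty.
by apply: cvg_comp up_cvg0 _; exact: cvg_gauss_prim_pinfty.
Qed.

Let A2_cvgy : A2 x @[x --> +oo] --> sb^-1 * (E * p2 - E^-1 * p2).
Proof.
apply: cvgMr; apply: cvgB; apply: cvgMr.
  by apply: cvg_comp um_cvgy _; exact: cvg_gauss_prim_pinfty.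
by apply: cvg_comp up_cvgy _; exact: cvg_gauss_prim_pinfty.
Qed.

Let A2_cvg0 : A2 x @[x --> (0:R)^'+] --> sb^-1 * (E * - p2 - E^-1 * p2).
Proof.
apply: cvgMr; apply: cvgB; apply: cvgMr.
  by apply: cvg_comp um_cvg0 _; exact: cvg_gauss_prim_ninfty.
by apply: cvg_comp up_cvg0 _; exact: cvg_gauss_prim_pinfty.
Qed.

Lemma bessel_ker1_integral : mu.-integrable `]0, +oo[ (EFin \o K 1) /\
  \int[mu]_(x in `]0, +oo[) K 1 x = Num.sqrt pi * expR (- c) / sa.
Proof.
have [i ->] := ge0_FTC_oo (@bessel_ker_ge0 1) (@bessel_ker_continuous 1)
  (@bessel_ker_cvg0 1) dA1 A1_cvg0 A1_cvgy.
by split => //; rewrite /p2 -/E; field; rewrite E0 gt_eqF.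
Qed.

Lemma bessel_ker2_integral : mu.-integrable `]0, +oo[ (EFin \o K 2) /\
  \int[mu]_(x in `]0, +oo[) K 2 x = Num.sqrt pi * expR (- c) / sb.
Proof.
have [i ->] := ge0_FTC_oo (@bessel_ker_ge0 2) (@bessel_ker_continuous 2)
  (@bessel_ker_cvg0 2) dA2 A2_cvg0 A2_cvgy.
by split => //; rewrite /p2 -/E; field; rewrite E0 gt_eqF.
Qed.

(** Differentiating the kernel of index 0 gives
    K 0' = K 1 / 2 - a K 0 + b K 2, which expresses a K 0 by an exact derivative
    and kernels already integrated; for K 3 the same is done with K 1'. *)
Let dA0 (x : R) : 0 < x -> is_derive x 1
  (fun x => a^-1 * (2^-1 * A1 x + b * A2 x - K 0 x)) (K 0 x).
Proof.
move=> x0; have d1 := dA1 x0; have d2 := dA2 x0.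
have di := is_derive1_inv x0; have ds := is_derive1_sqrt x0.
rewrite {1}/bessel_ker; under eq_fun do rewrite expr0 mulr1.
apply: trigger_derive; rewrite /GRing.scale /= /bessel_ker.
have s0 : Num.sqrt x != 0 by rewrite gt_eqF// sqrtr_gt0.
set e := expR _.
have xx := sqE x0; set s := Num.sqrt x in xx s0 *; rewrite xx.
by field; rewrite s0 gt_eqF.
Qed.

Lemma bessel_ker0_integral : mu.-integrable `]0, +oo[ (EFin \o K 0) /\
  \int[mu]_(x in `]0, +oo[) K 0 x =
  Num.sqrt pi * expR (- c) * ((2 * sa)^-1 + sb) / a.
Proof.
have l0 : (fun x => a^-1 * (2^-1 * A1 x + b * A2 x - K 0 x)) x @[x --> (0:R)^'+]
  --> a^-1 * (2^-1 * (sa^-1 * (E * - p2 + E^-1 * p2)) +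
       b * (sb^-1 * (E * - p2 - E^-1 * p2)) - 0).
  apply: cvgMr; apply: cvgB; last exact: bessel_ker_cvg0.
  by apply: cvgD; apply: cvgMr; [exact: A1_cvg0|exact: A2_cvg0].
have ly : (fun x => a^-1 * (2^-1 * A1 x + b * A2 x - K 0 x)) x @[x --> +oo]
  --> a^-1 * (2^-1 * (sa^-1 * (E * p2 + E^-1 * p2)) +
       b * (sb^-1 * (E * p2 - E^-1 * p2)) - 0).
  apply: cvgMr; apply: cvgB; last exact: bessel_ker_cvgy.
  by apply: cvgD; apply: cvgMr; [exact: A1_cvgy|exact: A2_cvgy].
have [i ->] := ge0_FTC_oo (@bessel_ker_ge0 0) (@bessel_ker_continuous 0)
  (@bessel_ker_cvg0 0) dA0 l0 ly.
split => //; rewrite /p2 -/E [in LHS]sbE.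
by field; rewrite E0 !gt_eqF.
Qed.

Let dA3 (x : R) : 0 < x -> is_derive x 1
  (fun x => b^-1 * (2^-1 * A2 x + a * A1 x + K 1 x)) (K 3 x).
Proof.
move=> x0; have d1 := dA1 x0; have d2 := dA2 x0.
have di := is_derive1_inv x0; have ds := is_derive1_sqrt x0.
rewrite {1}/bessel_ker; under eq_fun do rewrite expr1.
apply: trigger_derive; rewrite /GRing.scale /= /bessel_ker.
have s0 : Num.sqrt x != 0 by rewrite gt_eqF// sqrtr_gt0.
set e := expR _.
have xx := sqE x0; set s := Num.sqrt x in xx s0 *; rewrite xx.
by field; rewrite s0 gt_eqF.
Qed.

Lemma bessel_ker3_integral : mu.-integrable `]0, +oo[ (EFin \o K 3) /\
  \int[mu]_(x in `]0, +oo[) K 3 x =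
  Num.sqrt pi * expR (- c) * ((2 * sb)^-1 + sa) / b.
Proof.
have l0 : (fun x => b^-1 * (2^-1 * A2 x + a * A1 x + K 1 x)) x @[x --> (0:R)^'+]
  --> b^-1 * (2^-1 * (sb^-1 * (E * - p2 - E^-1 * p2)) +
       a * (sa^-1 * (E * - p2 + E^-1 * p2)) + 0).
  apply: cvgMr; apply: cvgD; last exact: bessel_ker_cvg0.
  by apply: cvgD; apply: cvgMr; [exact: A2_cvg0|exact: A1_cvg0].
have ly : (fun x => b^-1 * (2^-1 * A2 x + a * A1 x + K 1 x)) x @[x --> +oo]
  --> b^-1 * (2^-1 * (sb^-1 * (E * p2 - E^-1 * p2)) +
       a * (sa^-1 * (E * p2 + E^-1 * p2)) + 0).
  apply: cvgMr; apply: cvgD; last exact: bessel_ker_cvgy.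
  by apply: cvgD; apply: cvgMr; [exact: A2_cvgy|exact: A1_cvgy].
have [i ->] := ge0_FTC_oo (@bessel_ker_ge0 3) (@bessel_ker_continuous 3)
  (@bessel_ker_cvg0 3) dA3 l0 ly.
split => //; rewrite /p2 -/E [in LHS]saE.
by field; rewrite E0 !gt_eqF.
Qed.

End fixed_parameters.
End BesselIntegrals.

(** * Integration of exponentially decaying functions *)

Section ExponentialDecay.
Variable R : realType.
Notation mu := (@lebesgue_measure R).

Lemma exprn_le_fact_expR (j : nat) (u : R) : 0 <= u -> u ^+ j <= j`!%:R * expR u.
Proof.
move=> u0; case: j => [|j]; first by rewrite expr0 mul1r -expR0 ler_expR.
rewrite mulrC -ler_pdivrMr ?ltr0n ?fact_gt0//.
by apply: le_trans (expR_ge1Dxn j u0); rewrite lerDr.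
Qed.

(** Completing the square, a u^2 - 2 u + 1/a >= 0, compares a Gaussian with
    e^(-2u); one factor e^(-u) absorbs the power of u. *)
Lemma gauss_moment_le (a : R) (j : nat) (u : R) : 0 < a -> 0 <= u ->
  u ^+ j * expR (- (a * u ^+ 2)) <= j`!%:R * expR a^-1 * expR (- u).
Proof.
move=> a0 u0.
apply: (@le_trans _ _ (j`!%:R * expR u * expR (- (a * u ^+ 2)))).
  by rewrite ler_pM2r ?expR_gt0// exprn_le_fact_expR.
rewrite -!mulrA -!expRD ler_pM2l ?ltr0n ?fact_gt0// ler_expR -subr_ge0.
rewrite (_ : _ - _ = a * (u - a^-1) ^+ 2); last by field; rewrite gt_eqF.
by rewrite mulr_ge0 ?sqr_ge0 ?ltW.
Qed.

Lemma integral_expRN : mu.-integrable `[0, +oo[ (fun u : R => (expR (- u))%:E) /\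
  (\int[mu]_(u in `[0%R, +oo[) (expR (- u))%:E)%E = 1%:E.
Proof.
have dF (u : R) : is_derive u 1 (fun u => - expR (- u)) (expR (- u)).
  by apply: trigger_derive; rewrite mulrN1 opprK.
have c1 : continuous (fun u : R => expR (- u)).
  by move=> u; exact: is_derive_continuous.
have I : (\int[mu]_(u in `[0%R, +oo[) (expR (- u))%:E)%E = 1%:E.
  rewrite (@ge0_continuous_FTC2y _ _ (fun u => - expR (- u)) _ 0).
  - by rewrite oppr0 expR0 -EFinB sub0r opprK.
  - by move=> u _; exact: expR_ge0.
  - exact: continuous_subspaceT.
  - by rewrite -[X in _ --> X]oppr0; apply: cvgN; exact: cvgr_expR.
  - by move=> u _; have [] := dF u.
  - apply: cvg_at_right_filter; apply: (is_derive_continuous (dF 0)).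
  - by move=> u _; rewrite derive1E (@derive_val _ _ _ _ _ _ _ (dF u)).
split => //; apply/integrableP; split.
  by apply/measurable_EFinP/measurable_funTS; exact: continuous_measurable_fun.
under eq_integral do rewrite gee0_abs ?lee_fin ?expR_ge0//.
by rewrite I ltry.
Qed.

Lemma integrable_le_expRN (h : R -> R) (C : R) : continuous h ->
  (forall u : R, 0 <= u -> `|h u| <= C * expR (- u)) ->
  mu.-integrable `[0, +oo[ (EFin \o h).
Proof.
move=> ch hC.
apply: (@le_integrable _ _ _ mu _ _ _ (fun u => (C%:E * (expR (- u))%:E)%E)).
- exact: measurable_itv.
- by apply/measurable_EFinP/measurable_funTS; exact: continuous_measurable_fun.
- move=> u /=; rewrite in_itv/= andbT => u0; rewrite lee_fin.
  exact: (le_trans (hC _ u0)) (ler_norm _).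
- by apply: integrableZl; [exact: measurable_itv|exact: integral_expRN.1].
Qed.

(** The half-line fundamental theorem is available for nonnegative integrands;
    adding C e^(-u) to h makes it so. *)
Lemma FTC_le_expRN (h F : R -> R) (C l : R) : continuous h ->
  (forall u : R, 0 <= u -> `|h u| <= C * expR (- u)) ->
  (forall u : R, is_derive u 1 F (h u)) -> F u @[u --> +oo] --> l ->
  \int[mu]_(u in `[0, +oo[) h u = l - F 0.
Proof.
move=> ch hC dF Fl.
have ih := integrable_le_expRN ch hC.
have [ie Ie] := integral_expRN.
have iCe : mu.-integrable `[0, +oo[ (EFin \o (fun u : R => C * expR (- u))).
  have -> : EFin \o (fun u : R => C * expR (- u)) =
    (fun u => (C%:E * (expR (- u))%:E)%E) by apply/funext.
  by apply: integrableZl => //; exact: measurable_itv.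
have dG (u : R) : is_derive u 1 (fun u => F u - C * expR (- u))
    (h u + C * expR (- u)).
  have d := dF u; apply: trigger_derive; rewrite /GRing.scale /=; ring.
have c2 : continuous (fun u : R => h u + C * expR (- u)).
  have c3 (u : R) : {for u, continuous (fun u => C * expR (- u))}.
    exact: is_derive_continuous.
  by move=> u; exact: cvgD (ch u) (c3 u).
have : \int[mu]_(u in `[0, +oo[) (h u + C * expR (- u)) = l - (F 0 - C).
  rewrite (@Rintegral_ge0_continuous_FTC2y _ _ (fun u => F u - C * expR (- u)) _ l).
  - by rewrite oppr0 expR0 mulr1.
  - move=> u u0; have := hC u u0; rewrite ler_norml => /andP[+ _]; lra.
  - exact: continuous_subspaceT.
  - rewrite -[X in _ --> X]subr0 -[X in _ --> _ - X](mulr0 C).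
    by apply: cvgB => //; apply: cvgMr; exact: cvgr_expR.
  - by move=> u _; have [] := dG u.
  - apply: cvg_at_right_filter; exact: (is_derive_continuous (dG 0)).
  - by move=> u _; rewrite derive1E (@derive_val _ _ _ _ _ _ _ (dG u)).
rewrite RintegralD//.
rewrite RintegralZl//.
rewrite [X in C * X](_ : _ = 1); last by rewrite /Rintegral Ie.
by lra.
Qed.

End ExponentialDecay.

(** * Cosine transforms of Gaussian moments *)

Section GaussFourier.
Variable R : realType.
Notation mu := (@lebesgue_measure R).
Variable a : R.
Hypothesis a0 : 0 < a.

Let g (u : R) := expR (- (a * u ^+ 2)).

(** The phase j pi / 2 makes gauss_osc j the j-th derivative of gauss_osc 0 in
    the frequency s. *)
Definition gauss_osc (j : nat) (s u : R) :=
  u ^+ j * expR (- (a * u ^+ 2)) * cos (s * u + j%:R * (pi / 2)).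

Definition gauss_fourier (j : nat) (s : R) :=
  \int[mu]_(u in `[0, +oo[) gauss_osc j s u.

Let cg j : continuous (fun u : R => u ^+ j * expR (- (a * u ^+ 2))).
Proof.
move=> u; have d := is_derive_exprn j (is_derive_id u 1).
exact: is_derive_continuous.
Qed.

Lemma continuous_gauss_osc j s : continuous (gauss_osc j s).
Proof.
move=> u; apply: cvgM; first exact: cg.
exact: is_derive_continuous.
Qed.

Lemma gauss_osc_le j s u : 0 <= u ->
  `|gauss_osc j s u| <= j`!%:R * expR a^-1 * expR (- u).
Proof.
move=> u0; rewrite /gauss_osc normrM ger0_norm ?mulr_ge0 ?exprn_ge0 ?expR_ge0//.
apply: le_trans (gauss_moment_le j a0 u0).
by rewrite ler_piMr ?mulr_ge0 ?exprn_ge0 ?expR_ge0 ?cos_max.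
Qed.

Lemma integrable_gauss_osc j s : mu.-integrable `[0, +oo[ (EFin \o gauss_osc j s).
Proof.
apply: integrable_le_expRN; first exact: continuous_gauss_osc.
by move=> u; exact: gauss_osc_le.
Qed.

Let cosS j (x : R) : - sin (x + j%:R * (pi / 2)) = cos (x + j.+1%:R * (pi / 2)).
Proof. by rewrite -cosDpihalf; congr cos; rewrite -natr1; ring. Qed.

Let docs (j : nat) (s u : R) : is_derive s 1 (fun s => gauss_osc j s u) (gauss_osc j.+1 s u).
Proof.
rewrite /gauss_osc; apply: trigger_derive.
rewrite /GRing.scale /= -cosS (exprSr u j); ring.
Qed.

Lemma is_derive_gauss_fourier (j : nat) (s : R) :
  is_derive s 1 (gauss_fourier j) (gauss_fourier j.+1 s).
Proof.
pose G (u : R) : R := `|u ^+ j.+1 * expR (- (a * u ^+ 2))|.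
have Is : (`]s - 1, s + 1[%classic : set R) s.
  by rewrite /= in_itv/=; apply/andP; split; lra.
have i1 x : (`]s - 1, s + 1[%classic : set R) x ->
  mu.-integrable `[0, +oo[ (EFin \o gauss_osc j x).
  by move=> _; exact: integrable_gauss_osc.
have i2 x u : (`]s - 1, s + 1[%classic : set R) x -> (`[0, +oo[%classic : set R) u ->
  derivable ((gauss_osc j) ^~ u) x 1.
  by move=> _ _; have [] := docs j x u.
have iG : mu.-integrable `[0, +oo[ (EFin \o G).
  apply: (@integrable_le_expRN _ _ (j.+1`!%:R * expR a^-1)).
    by move=> u; apply: cvg_norm; exact: cg.
  move=> u u0; rewrite normr_id ger0_norm ?mulr_ge0 ?exprn_ge0 ?expR_ge0//.
  exact: gauss_moment_le.
have dE x u : derive1 ((gauss_osc j) ^~ u) x = gauss_osc j.+1 x u.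
  by rewrite derive1E (@derive_val _ _ _ _ _ _ _ (docs j x u)).
have lG x u : (`]s - 1, s + 1[%classic : set R) x -> (`[0, +oo[%classic : set R) u ->
  `|derive1 ((gauss_osc j) ^~ u) x| <= G u.
  move=> _ _; rewrite dE /gauss_osc normrM -/(G u).
  by rewrite ler_piMr ?normr_ge0 ?cos_max.
have mI : measurable (`[0, +oo[%classic : set R) by exact: measurable_itv.
have G0 u : 0 <= G u by exact: normr_ge0.
apply: DeriveDef.
  exact: (@derivable_under_integral _ _ _ mu _ _ mI _ _ _ Is i1 i2 _ G0 iG lG).
rewrite -derive1E.
rewrite (@differentiation_under_integral _ _ _ mu _ _ mI _ _ _ Is i1 i2 _ G0 iG lG).
by apply: eq_Rintegral => u _; rewrite -dE.
Qed.

Let cvg_expRNy (C : R) : C * expR (- u) @[u --> +oo] --> (0:R).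
Proof. by rewrite -[X in _ --> X](mulr0 C); apply: cvgMr; exact: cvgr_expR. Qed.

Lemma gauss_fourier0_0 : gauss_fourier 0 0 = Num.sqrt pi / (2 * Num.sqrt a).
Proof.
have s0 : 0 < Num.sqrt a by rewrite sqrtr_gt0.
have E : gauss_fourier 0 0 = \int[mu]_(u in `[0, +oo[) expR (- (Num.sqrt a * u) ^+ 2).
  apply: eq_Rintegral => u _.
  by rewrite /gauss_osc expr0 mul1r !mul0r addr0 cos0 mulr1 exprMn sqr_sqrtr ?ltW.
rewrite E.
pose F (u : R) := (Num.sqrt a)^-1 * gauss_prim (Num.sqrt a * u).
have dF (u : R) : is_derive u 1 F (expR (- (Num.sqrt a * u) ^+ 2)).
  have d : is_derive u 1 (fun u => gauss_prim (Num.sqrt a * u))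
    (expR (- (Num.sqrt a * u) ^+ 2) * Num.sqrt a).
    by apply: is_derive1_comp; apply: trigger_derive; rewrite /GRing.scale /= mulr1.
  apply: trigger_derive; rewrite /GRing.scale /= mulrCA mulVf ?mulr1// gt_eqF//.
rewrite (@FTC_le_expRN _ _ F (0`!%:R * expR a^-1) ((Num.sqrt a)^-1 * (Num.sqrt pi / 2))).
- rewrite /F mulr0 (_ : gauss_prim 0 = 0); last by rewrite /gauss_prim subrr.
  by rewrite mulr0 subr0; field; rewrite gt_eqF.
- by move=> u; exact: is_derive_continuous.
- move=> u u0; rewrite ger0_norm ?expR_ge0// exprMn sqr_sqrtr ?(ltW a0)//.
  by have := gauss_moment_le 0 a0 u0; rewrite expr0 mul1r.
- apply: cvgMr; apply: cvg_comp (@cvg_gauss_prim_pinfty R).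
  by apply: gt0_cvgMry => //; exact: cvg_id.
Qed.

(** The integral of the derivative of e^(-a u^2) sin (s u) vanishes. Together with
    is_derive_gauss_fourier this is the differential equation
    y' = - s / (2a) y for y = gauss_fourier 0. *)
Lemma gauss_fourier1 s :
  gauss_fourier 1 s = - (s / (2 * a)) * gauss_fourier 0 s.
Proof.
pose F (u : R) := g u * sin (s * u).
pose h (u : R) := 2 * a * gauss_osc 1 s u + s * gauss_osc 0 s u.
have dF (u : R) : is_derive u 1 F (h u).
  apply: trigger_derive; rewrite /GRing.scale /= /h /gauss_osc -cosS mul0r !addr0.
  by rewrite expr0 expr1 /g; ring.
have F0 : F u @[u --> +oo] --> (0:R).
  have P : `|F u| @[u --> +oo] --> (0:R).
    apply: (@squeeze_cvgr _ _ _ _ (cst 0) (fun u => 0`!%:R * expR a^-1 * expR (- u))).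
    - near=> u; rewrite normr_ge0/=.
      have u0 : 0 <= u by [].
      apply: le_trans (gauss_moment_le 0 a0 u0).
      rewrite expr0 mul1r normrM ger0_norm ?expR_ge0//.
      by rewrite ler_piMr ?expR_ge0 ?sin_max.
    - exact: cvg_cst.
    - exact: cvg_expRNy.
  exact: norm_cvg0.
have I : \int[mu]_(u in `[0, +oo[) h u = 0 - F 0.
  apply: (@FTC_le_expRN _ _ _ (2 * a * (1`!%:R * expR a^-1) + `|s| * (0`!%:R * expR a^-1))).
  - by move=> u; apply: cvgD; apply: cvgMr; exact: continuous_gauss_osc.
  - move=> u u0; apply: (le_trans (ler_normD _ _)).
    have a2 : 0 <= 2 * a by rewrite mulr_ge0 ?(ltW a0).
    rewrite (normrM (2 * a)) (normrM s) (ger0_norm a2).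
    have h1 := ler_wpM2l a2 (gauss_osc_le 1 s u0).
    have h0 := ler_wpM2l (normr_ge0 s) (gauss_osc_le 0 s u0).
    by apply: le_trans (lerD h1 h0) _; rewrite le_eqVlt; apply/orP; left; apply/eqP; ring.
  - exact: F0.
move: I; rewrite /F mulr0 sin0 mulr0 subr0 /h.
have i0 := integrable_gauss_osc 0 s; have i1 := integrable_gauss_osc 1 s.
have iZ j k : mu.-integrable `[0, +oo[ (EFin \o (fun u => k * gauss_osc j s u)).
  have -> : EFin \o (fun u => k * gauss_osc j s u) =
    (fun u => (k%:E * (gauss_osc j s u)%:E)%E) by apply/funext.
  by apply: integrableZl; [exact: measurable_itv|exact: integrable_gauss_osc].
rewrite RintegralD//.
rewrite RintegralZl//.
rewrite RintegralZl//.
rewrite -!/(gauss_fourier _ _) => I.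
have -> : gauss_fourier 1 s = (2 * a)^-1 * (2 * a * gauss_fourier 1 s +
  s * gauss_fourier 0 s) - s / (2 * a) * gauss_fourier 0 s.
  by field; rewrite gt_eqF.
by rewrite I mulr0 sub0r mulNr.
Unshelve. all: by end_near. Qed.

Lemma gauss_fourier0 s :
  gauss_fourier 0 s = Num.sqrt pi / (2 * Num.sqrt a) * expR (- (s ^+ 2 / (4 * a))).
Proof.
pose e (s : R) := expR (s ^+ 2 / (4 * a)).
suff d (x : R) : is_derive x 1 (fun s => gauss_fourier 0 s * e s) 0.
  have := is_derive_0_is_cst s 0 d.
  rewrite gauss_fourier0_0 {2}/e expr0n/= mul0r expR0 mulr1 => <-.
  by rewrite -mulrA -expRD subrr expR0 mulr1.
have d := is_derive_gauss_fourier 0 x.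
apply: trigger_derive; rewrite /GRing.scale /= gauss_fourier1 /e.
by field; rewrite gt_eqF.
Qed.

Let c := (2 * a)^-1.

Let unique_derive (f f' : R -> R) (x d d' : R) : is_derive x 1 f d ->
  (f = f') -> is_derive x 1 f' d' -> d = d'.
Proof. by move=> [_ <-] -> [_ <-]. Qed.

(** Each transform is the derivative of the preceding one, so differentiating the
    closed form repeatedly yields Hermite polynomials times the Gaussian. *)
Lemma gauss_fourier2 s :
  gauss_fourier 2 s = ((s * c) ^+ 2 - c) * gauss_fourier 0 s.
Proof.
apply: (unique_derive (is_derive_gauss_fourier 1 s) (f' := fun s => - (s / (2 * a)) * gauss_fourier 0 s)).
  by apply/funext => x; exact: gauss_fourier1.
have d := is_derive_gauss_fourier 0 s.
apply: trigger_derive; rewrite /GRing.scale /= gauss_fourier1 /c.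
by field; rewrite gt_eqF.
Qed.

Lemma gauss_fourier3 s :
  gauss_fourier 3 s = (3 * c * (s * c) - (s * c) ^+ 3) * gauss_fourier 0 s.
Proof.
apply: (unique_derive (is_derive_gauss_fourier 2 s) (f' := fun s => ((s * c) ^+ 2 - c) * gauss_fourier 0 s)).
  by apply/funext => x; exact: gauss_fourier2.
have d := is_derive_gauss_fourier 0 s.
apply: trigger_derive; rewrite /GRing.scale /= gauss_fourier1 /c.
by field; rewrite gt_eqF.
Qed.

Lemma gauss_fourier4 s : gauss_fourier 4 s =
  ((s * c) ^+ 4 - 6 * c * (s * c) ^+ 2 + 3 * c ^+ 2) * gauss_fourier 0 s.
Proof.
apply: (unique_derive (is_derive_gauss_fourier 3 s) (f' := fun s => (3 * c * (s * c) - (s * c) ^+ 3) * gauss_fourier 0 s)).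
  by apply/funext => x; exact: gauss_fourier3.
have d := is_derive_gauss_fourier 0 s.
apply: trigger_derive; rewrite /GRing.scale /= gauss_fourier1 /c.
by field; rewrite gt_eqF.
Qed.

End GaussFourier.

(** * Powers of the cosine *)

Section CosinePowers.
Variable R : realType.
Notation mu := (@lebesgue_measure R).

Lemma expr_cos_sum (t : R) (n : nat) : (2 * cos t) ^+ n =
  \sum_(j < n.+1) 'C(n, j)%:R * cos ((j%:R *+ 2 - n%:R) * t).
Proof.
elim: n => [|n IH].
  by rewrite big_ord1 expr0 bin0 mul1r mul0rn subr0 mul0r cos0.
have e (j : nat) : 2 * cos t * cos ((j%:R *+ 2 - n%:R) * t) =
  cos ((j.+1%:R *+ 2 - n.+1%:R) * t) + cos ((j%:R *+ 2 - n.+1%:R) * t).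
  rewrite (_ : (j.+1%:R *+ 2 - n.+1%:R) * t = (j%:R *+ 2 - n%:R) * t + t); last first.
    by rewrite -!natr1; ring.
  rewrite (_ : (j%:R *+ 2 - n.+1%:R) * t = (j%:R *+ 2 - n%:R) * t - t); last first.
    by rewrite -!natr1; ring.
  by rewrite cosD cosB; ring.
rewrite exprS IH big_distrr /=.
under eq_bigr do rewrite mulrCA e mulrDr.
rewrite big_split /= addrC.
rewrite [in RHS]big_ord_recl /= bin0.
under [in RHS]eq_bigr do rewrite /bump /= add1n binS natrD mulrDl.
rewrite big_split /= addrA; congr (_ + _).
  rewrite big_ord_recl /= bin0; congr (_ + _).
  by rewrite big_ord_recr /= bin_small // mul0r addr0.
Qed.

(** The inequality v <= tan v, in a form without division. *)
Lemma sin_ge_mulcos (v : R) : 0 <= v <= pi -> v * cos v <= sin v.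
Proof.
move=> /andP[v0 vpi].
pose f (v : R) := sin v - v * cos v.
have df (x : R) : is_derive x 1 f (x * sin x).
  by apply: trigger_derive; rewrite /GRing.scale /=; ring.
have : f 0 <= f v.
  apply: (@ger0_derive1_le_cc _ f 0 pi) => //.
  - move=> x; rewrite in_itv /= => /andP[x0 xpi].
    rewrite derive1E (@derive_val _ _ _ _ _ _ _ (df x)).
    by rewrite mulr_ge0 ?(ltW x0)// sin_ge0_pi// (ltW x0) ltW.
  - by apply: continuous_subspaceT => x; exact: is_derive_continuous.
  - by rewrite in_itv /= lexx pi_ge0.
  - by rewrite in_itv /= v0 vpi.
by rewrite /f sin0 mul0r subrr subr_ge0.
Qed.

(** With w = pi t / 2 one has sin (pi t) = 2 sin w cos w >= 2 w cos^2 w, and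
    cos^2 w >= 1/2 because 2 w <= pi / 2; finally pi >= 2. *)
Lemma norm_le_norm_sin (t : R) : `|t| <= 2^-1 -> `|t| <= `|sin (pi * t)|.
Proof.
wlog t0 : t / 0 <= t.
  move=> H; have [/H//|/ltW t0] := leP 0 t; move=> h.
  by have := H (- t); rewrite oppr_ge0 mulrN sinN !normrN => /(_ t0 h).
rewrite (ger0_norm t0) => t2.
have pi0 := @pi_gt0 R; have pi2 := @pi_ge2 R.
have [w wE] : exists w, w = pi * t / 2 by exists (pi * t / 2).
have w0 : 0 <= w by rewrite wE !mulr_ge0 ?(ltW pi0).
have w4 : w <= pi / 4 by rewrite wE; nra.
have c0 : 0 <= cos (w *+ 2).
  by apply: cos_ge0_pihalf; rewrite (mulr2n w); apply/andP; split; lra.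
have cw : 0 <= cos w by apply: cos_ge0_pihalf; apply/andP; split; lra.
have sw : w * cos w <= sin w by apply: sin_ge_mulcos; rewrite w0 /=; lra.
have E : sin (pi * t) = 2 * (sin w * cos w).
  rewrite (_ : pi * t = w *+ 2); last by rewrite wE; field.
  by rewrite sin_mulr2n (mulr2n (_ * _)); ring.
apply: le_trans (ler_norm _); rewrite E.
have c2 : 2^-1 <= cos w ^+ 2.
  by move: c0; rewrite cos_mulr2n; lra.
have : w * cos w ^+ 2 <= sin w * cos w by rewrite expr2 mulrA ler_wpM2r.
have : w * 2^-1 <= w * cos w ^+ 2 by rewrite ler_wpM2l.
have : t <= w by rewrite wE; nra.
lra.
Qed.

Lemma sin_pi_subn_sqr (u : R) (m : nat) : sin (pi * (u - m%:R)) ^+ 2 = sin (pi * u) ^+ 2.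
Proof.
have -> : pi * u = pi * (u - m%:R) + pi *+ m by rewrite -mulr_natr; ring.
by rewrite (alternatingn (@sinDpi R)) exprMn sqrr_sign mul1r.
Qed.

Lemma sin_pi_natr (m : nat) : sin (pi * m%:R) = 0 :> R.
Proof.
have -> : pi * m%:R = 0 + pi *+ m :> R by rewrite add0r mulr_natr.
by rewrite (alternatingn (@sinDpi R)) sin0 mulr0.
Qed.

Lemma cos_pi_half_odd (m : nat) : cos (pi * (m%:R + 2^-1)) = 0 :> R.
Proof. by rewrite mulrDr cosDpihalf sin_pi_natr oppr0. Qed.

End CosinePowers.

(** * Concentration of even powers of the cosine at the integers *)

Section CosineKernel.
Variable R : realType.
Notation mu := (@lebesgue_measure R).

Lemma continuous_itv_integrable (h : R -> R) (p q : R) : continuous h ->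
  mu.-integrable `[p, q] (EFin \o h).
Proof.
move=> ch; apply: continuous_compact_integrable; first exact: segment_compact.
exact: continuous_subspaceT.
Qed.

Lemma Rintegral_itv_lin (h k : R -> R) (p q c d : R) : continuous h -> continuous k ->
  \int[mu]_(u in `[p, q]) (c * h u + d * k u) =
  c * \int[mu]_(u in `[p, q]) h u + d * \int[mu]_(u in `[p, q]) k u.
Proof.
move=> ch ck.
have cZ (f : R -> R) e : continuous f -> continuous (fun u => e * f u).
  by move=> cf u; apply: cvgMr; exact: cf.
have m : measurable (`[p, q]%classic : set R) by exact: measurable_itv.
rewrite RintegralD//; try (apply: continuous_itv_integrable; exact: cZ).
by rewrite !RintegralZl//; exact: continuous_itv_integrable.
Qed.

Lemma continuous_cos_even (N : nat) : continuous (fun u : R => cos (pi * u) ^+ N.*2).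
Proof.
move=> u; have d := is_derive_exprn N.*2 (_ : is_derive u 1 (fun u => cos (pi * u)) _).
exact: (is_derive_continuous (d _ _)).
Qed.

(** The mean over a period of cos^(2N) (pi u). *)
Definition wallis (N : nat) : R := 'C(N.*2, N)%:R / 4 ^+ N.

Lemma wallis_gt0 N : 0 < wallis N.
Proof.
by rewrite divr_gt0 ?exprn_gt0// ltr0n bin_gt0 -addnn leq_addr.
Qed.

Lemma wallisS N : wallis N.+1 * (N.+1%:R *+ 2) = wallis N * (N%:R *+ 2 + 1).
Proof.
have h : ('C(N.+1.*2, N.+1) * N.+1 = 'C(N.*2, N) * (2 * N.*2.+1))%N.
  have h1 := mul_bin_left N.*2.+1 N.
  have h2 := mul_bin_diag N.*2.+1 N.
  rewrite doubleS binS; move: h1 h2 => /=.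
  have -> : (N.*2.+1 - N = N.+1)%N by lia.
  nia.
rewrite /wallis exprS.
have H : 'C(N.+1.*2, N.+1)%:R * N.+1%:R = 'C(N.*2, N)%:R * (2 * (N%:R *+ 2 + 1)) :> R.
  have -> : N%:R *+ 2 + 1 = N.*2.+1%:R :> R by rewrite -natr1 -muln2 natrM mulr_natr.
  by have /(congr1 (fun n => n%:R : R)) := h; rewrite !natrM.
have f0 : (4 : R) ^+ N != 0 by rewrite expf_neq0.
rewrite -[_ *+ 2]mulr_natr.
transitivity ('C(N.+1.*2, N.+1)%:R * N.+1%:R / (2 * 4 ^+ N) : R); first by field.
by rewrite H; field.
Qed.

(** Integration by parts lowers N; the boundary terms vanish at integers and at
    half-integers, which is what the two hypotheses on p and q say. *)
Lemma integral_cos_even (N : nat) (p q : R) : p < q ->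
  cos (pi * p) * sin (pi * p) = 0 -> cos (pi * q) * sin (pi * q) = 0 ->
  \int[mu]_(u in `[p, q]) cos (pi * u) ^+ N.*2 = wallis N * (q - p).
Proof.
move=> pq Hp Hq.
elim: N => [|N IH].
  under eq_Rintegral do rewrite expr0.
  rewrite Rintegral_cst//= lebesgue_measure_itv/= lte_fin pq/= mul1r.
  by rewrite /wallis expr0 bin0 divr1 mul1r.
have pi0 := @pi_gt0 R.
pose F (u : R) := pi^-1 * (cos (pi * u) ^+ N.*2.+1 * sin (pi * u)).
have dF (u : R) : is_derive u 1 F ((N.+1%:R *+ 2) * cos (pi * u) ^+ N.+1.*2 +
    - (N%:R *+ 2 + 1) * cos (pi * u) ^+ N.*2).
  have dc : is_derive u 1 (fun u => cos (pi * u)) (- (pi * sin (pi * u))).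
    by apply: trigger_derive; rewrite /GRing.scale /=; ring.
  have d := is_derive_exprn N.*2.+1 dc.
  apply: trigger_derive; rewrite /GRing.scale /=.
  have s2 := sin2cos2 (pi * u).
  rewrite doubleS !exprS -natr1 -muln2 natrM -natr1.
  set c := cos (pi * u) in s2 *; set s := sin _ in s2 *.
  set cN := c ^+ _.
  transitivity ((c * (c * cN) - (N%:R *+ 2 + 1) * cN * s ^+ 2)).
    clearbody c s cN; move: pi0; move: (@pi R) => P P0.
    by field; rewrite gt_eqF.
  by rewrite s2; ring.
have cc k : continuous (fun u : R => cos (pi * u) ^+ k.*2) by exact: continuous_cos_even.
have ch : continuous (fun u : R => (N.+1%:R *+ 2) * cos (pi * u) ^+ N.+1.*2 +
    - (N%:R *+ 2 + 1) * cos (pi * u) ^+ N.*2).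
  by move=> u; apply: cvgD; apply: cvgMr; exact: cc.
have : \int[mu]_(u in `[p, q]) ((N.+1%:R *+ 2) * cos (pi * u) ^+ N.+1.*2 +
    - (N%:R *+ 2 + 1) * cos (pi * u) ^+ N.*2) = F q - F p.
  rewrite /Rintegral (@continuous_FTC2 _ _ F)//.
  - exact: continuous_subspaceT.
  - split.
    + by move=> x _; have [] := dF x.
    + by apply: cvg_at_right_filter; exact: (is_derive_continuous (dF p)).
    + by apply: cvg_at_left_filter; exact: (is_derive_continuous (dF q)).
  - by move=> u _; rewrite derive1E (@derive_val _ _ _ _ _ _ _ (dF u)).
have F0 x : cos (pi * x) * sin (pi * x) = 0 -> F x = 0.
  by move=> h; rewrite /F exprSr -mulrA h !mulr0.
rewrite Rintegral_itv_lin// IH !F0// subrr.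
have n0 : (N.+1%:R *+ 2 : R) != 0 by rewrite mulrn_eq0 /= pnatr_eq0.
move=> I; apply: (mulfI n0); rewrite [RHS]mulrA [X in _ = X * _]mulrC wallisS.
by lra.
Qed.

Definition conc_rate (N : nat) : R := Num.sqrt N.+1%:R^-1.

Lemma conc_rate_gt0 N : 0 < conc_rate N.
Proof. by rewrite sqrtr_gt0 invr_gt0. Qed.

(** Near the integer m the error is at most B |u - m| <= B |sin (pi u)|, and the
    mean of |sin| against cos^(2N) is controlled by that of sin^2, which is of
    order 1/N relative to the total mass; conc_rate N = (N+1)^(-1/2) is the
    resulting rate. The interval may be half a period because the sum over the
    half-line gives weight 1/2 to the integer 0. *)
Lemma cos_even_concentration (f : R -> R) (m N : nat) (p q B : R) :
  continuous f -> 0 <= B -> p < q -> q - p <= 1 ->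
  cos (pi * p) * sin (pi * p) = 0 -> cos (pi * q) * sin (pi * q) = 0 ->
  (forall u, p <= u <= q -> `|u - m%:R| <= 2^-1) ->
  (forall u, p <= u <= q -> `|f u - f m%:R| <= B * `|u - m%:R|) ->
  `|\int[mu]_(u in `[p, q]) (f u * cos (pi * u) ^+ N.*2)
    - f m%:R * (wallis N * (q - p))| <= B * (conc_rate N * wallis N).
Proof.
move=> cf B0 pq pq1 Hp Hq um fB.
have cc k : continuous (fun u : R => cos (pi * u) ^+ k.*2) by exact: continuous_cos_even.
have cfc : continuous (fun u : R => f u * cos (pi * u) ^+ N.*2).
  by move=> u; apply: cvgM; [exact: cf|exact: cc].
have mI : measurable (`[p, q]%classic : set R) by exact: measurable_itv.
have c0 k (u : R) : 0 <= cos (pi * u) ^+ k.*2 by rewrite -muln2 exprM sqr_ge0.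
have d0 := conc_rate_gt0 N; set d := conc_rate N in d0 *.
have d2 : d ^+ 2 = N.+1%:R^-1 by rewrite sqr_sqrtr// invr_ge0.
have -> : \int[mu]_(u in `[p, q]) (f u * cos (pi * u) ^+ N.*2)
    - f m%:R * (wallis N * (q - p)) =
    \int[mu]_(u in `[p, q]) (1 * (f u * cos (pi * u) ^+ N.*2)
      + - f m%:R * cos (pi * u) ^+ N.*2).
  rewrite (Rintegral_itv_lin _ _ _ _ cfc (cc N)) integral_cos_even//.
  by rewrite mul1r mulNr.
have cD : continuous (fun u : R => 1 * (f u * cos (pi * u) ^+ N.*2)
      + - f m%:R * cos (pi * u) ^+ N.*2).
  by move=> u; apply: cvgD; apply: cvgMr; [exact: cfc|exact: cc].
apply: (le_trans (le_normr_Rintegral _ _)) => //.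
  exact: continuous_itv_integrable.
(* c1 and c2 encode |sin| <= (d + sin^2 / d) / 2 with sin^2 = 1 - cos^2 *)
pose c1 := B * (d / 2 + (2 * d)^-1); pose c2 := - (B / (2 * d)).
have cM : continuous (fun u : R => c1 * cos (pi * u) ^+ N.*2 + c2 * cos (pi * u) ^+ N.+1.*2).
  by move=> u; apply: cvgD; apply: cvgMr; exact: cc.
apply: (@le_trans _ _ (\int[mu]_(u in `[p, q]) (c1 * cos (pi * u) ^+ N.*2 + c2 * cos (pi * u) ^+ N.+1.*2))).
  apply: le_Rintegral => //.
  - by apply: continuous_itv_integrable => u; apply: cvg_norm; exact: cD.
  - exact: continuous_itv_integrable.
  - move=> u; rewrite /= in_itv/= => upq.
    rewrite mul1r mulNr -mulrBl normrM (ger0_norm (c0 _ _)).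
    have -> : c1 * cos (pi * u) ^+ N.*2 + c2 * cos (pi * u) ^+ N.+1.*2 =
      B * (d / 2 + (2 * d)^-1 * sin (pi * u) ^+ 2) * cos (pi * u) ^+ N.*2.
      rewrite sin2cos2 /c1 /c2 doubleS !exprS; field; rewrite gt_eqF//.
    apply: ler_wpM2r => //; apply: (le_trans (fB _ upq)); apply: ler_wpM2l => //.
    rewrite -(sin_pi_subn_sqr u m) -real_normK ?num_real//.
    apply: (le_trans (norm_le_norm_sin (um _ upq))).
    set s := `|sin _|; rewrite -subr_ge0.
    rewrite (_ : _ - _ = (2 * d)^-1 * (s - d) ^+ 2); last by field; rewrite gt_eqF.
    by rewrite mulr_ge0 ?sqr_ge0// invr_ge0 mulr_ge0 ?ltW.
rewrite Rintegral_itv_lin// !integral_cos_even//.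
have -> : wallis N.+1 = wallis N * (1 - d ^+ 2 / 2).
  have n0 : (N.+1%:R *+ 2 : R) != 0 by rewrite mulrn_eq0 /= pnatr_eq0.
  apply: (mulIf n0); rewrite wallisS d2 -(mulrA (wallis N)); congr (_ * _).
  by rewrite -natr1; field; rewrite natr1 pnatr_eq0.
have -> : c1 * (wallis N * (q - p)) + c2 * (wallis N * (1 - d ^+ 2 / 2) * (q - p)) =
   (3 / 4 * (q - p)) * (B * (d * wallis N)).
  by rewrite /c1 /c2; field; rewrite gt_eqF.
rewrite ler_piMl ?mulr_ge0 ?(ltW d0) ?(ltW (wallis_gt0 N))//.
by lra.
Qed.

End CosineKernel.

(** * Poisson summation on the half-line *)

Section Poisson.
Variable R : realType.
Notation mu := (@lebesgue_measure R).

Lemma sum_expRN_le2 (n : nat) : \sum_(m < n) expR (- m%:R) <= 2 :> R.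
Proof.
suff h : \sum_(m < n) expR (- m%:R) <= 2 - 2 * (2^-1) ^+ n :> R.
  by apply: (le_trans h); rewrite gerDl oppr_le0 mulr_ge0 ?exprn_ge0.
elim: n => [|n IH]; first by rewrite big_ord0 expr0 mulr1 subrr.
rewrite big_ord_recr /=.
have e : expR (- n%:R) <= (2^-1) ^+ n :> R.
  rewrite -[n%:R]mul1r -mulNr expRM_natr; apply: lerXn2r.
  - by rewrite nnegrE expR_ge0.
  - by rewrite nnegrE invr_ge0.
  rewrite expRN lef_pV2 ?posrE ?expR_gt0//.
  by have := expR_ge1Dx (1 : R).
by rewrite exprS; lra.
Qed.

Lemma Rintegral_expRN_tail (q : R) :
  \int[mu]_(u in `]q, +oo[) expR (- u) = expR (- q).
Proof.
have dF (u : R) : is_derive u 1 (fun u => - expR (- u)) (expR (- u)).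
  by apply: trigger_derive; rewrite mulrN1 opprK.
have c1 : continuous (fun u : R => expR (- u)).
  by move=> u; exact: is_derive_continuous.
rewrite /Rintegral integral_itv_obnd_cbnd; last first.
  by apply/measurable_EFinP/measurable_funTS; exact: continuous_measurable_fun.
rewrite (@ge0_continuous_FTC2y _ _ (fun u => - expR (- u)) _ 0).
- by rewrite sub0e -EFinN opprK.
- by move=> u _; exact: expR_ge0.
- exact: continuous_subspaceT.
- by rewrite -[X in _ --> X]oppr0; apply: cvgN; exact: cvgr_expR.
- by move=> u _; have [] := dF u.
- by apply: cvg_at_right_filter; apply: (is_derive_continuous (dF q)).
- by move=> u _; rewrite derive1E (@derive_val _ _ _ _ _ _ _ (dF u)).
Qed.

Lemma Rintegral_tail_le (h : R -> R) (C q : R) : 0 <= q -> continuous h ->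
  (forall u : R, 0 <= u -> `|h u| <= C * expR (- u)) ->
  `|\int[mu]_(u in `[0, +oo[) h u - \int[mu]_(u in `[0, q]) h u| <= C * expR (- q).
Proof.
move=> q0 ch hC; have ih := integrable_le_expRN ch hC.
have [ie _] := integral_expRN R.
have mq : measurable (`]q, +oo[%classic : set R) by exact: measurable_itv.
have sq : `]q, +oo[%classic `<=` (`[0, +oo[%classic : set R).
  by move=> u; rewrite /= !in_itv/= !andbT => /ltW; exact: le_trans.
have m0 : measurable (`[0, +oo[%classic : set R) by exact: measurable_itv.
have ihq : mu.-integrable `]q, +oo[ (EFin \o h) by apply: (@integrableS _ _ _ mu _ _ _ _ _ sq ih).
have ieq : mu.-integrable `]q, +oo[ (EFin \o (fun u : R => expR (- u))).
  by apply: (@integrableS _ _ _ mu _ _ _ _ _ sq ie).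
rewrite Rintegral_itvB ?bnd_simp//.
apply: (le_trans (le_normr_Rintegral _ _)) => //.
rewrite -(Rintegral_expRN_tail q) -RintegralZl//.
apply: le_Rintegral => //.
- exact: integrable_norm.
- have -> : EFin \o (fun u : R => C * expR (- u)) =
    (fun u => (C%:E * (expR (- u))%:E)%E) by apply/funext.
  exact: integrableZl.
- by move=> u /sq; rewrite /= in_itv/= andbT => /hC.
Qed.

Lemma Rintegral_sum (D : set R) (n : nat) (h : nat -> R -> R) : measurable D ->
  (forall j, mu.-integrable D (EFin \o h j)) ->
  \int[mu]_(u in D) (\sum_(j < n) h j u) = \sum_(j < n) \int[mu]_(u in D) h j u.
Proof.
move=> mD ih.
have isum k : mu.-integrable D (EFin \o (fun u => \sum_(j < k) h j u)).
  have -> : EFin \o (fun u => \sum_(j < k) h j u) =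
    (fun u => (\sum_(j < k) (h j u)%:E)%E).
    by apply/funext => u /=; rewrite sumEFin.
  apply: integrable_sum => // j _; exact: ih.
elim: n => [|n IH].
  rewrite big_ord0; under eq_Rintegral do rewrite big_ord0.
  by rewrite Rintegral_cst// mul0r.
rewrite big_ord_recr /= -IH -RintegralD//.
by apply: eq_Rintegral => u _; rewrite big_ord_recr.
Qed.

(** Consecutive ratios are (N-k)/(N+k+1) = 1 - (2k+1)/(N+k+1), and the numbers
    2k+1 add up to k^2. *)
Lemma central_bin_ratio (N k : nat) :
  1 - k%:R ^+ 2 / N.+1%:R <= 'C(N.*2, N + k)%:R / 'C(N.*2, N)%:R :> R /\
  'C(N.*2, N + k)%:R / 'C(N.*2, N)%:R <= 1 :> R.
Proof.
have c0 : 0 < 'C(N.*2, N)%:R :> R by rewrite ltr0n bin_gt0 -addnn leq_addr.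
elim: k => [|k [IH1 IH2]].
  by rewrite addn0 divff ?gt_eqF// expr0n/= mul0r subr0 lexx.
have r0 : 0 <= 'C(N.*2, N + k)%:R / 'C(N.*2, N)%:R :> R by rewrite divr_ge0// ltW.
have N0 : 0 < N.+1%:R :> R by rewrite ltr0n.
have [kN|Nk] := ltnP k N; last first.
  rewrite (_ : 'C(N.*2, N + k.+1) = 0%N); last by rewrite bin_small//; lia.
  rewrite mul0r; split => //; rewrite subr_le0 ler_pdivlMr// mul1r.
  by rewrite -natrX ler_nat; nia.
have E : 'C(N.*2, N + k.+1)%:R / 'C(N.*2, N)%:R =
   'C(N.*2, N + k)%:R / 'C(N.*2, N)%:R * ((N - k)%:R / (N + k).+1%:R) :> R.
  have := mul_bin_left N.*2 (N + k).
  have -> : (N.*2 - (N + k) = N - k)%N by lia.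
  move/(congr1 (fun n => n%:R : R)); rewrite !natrM addnS => h.
  have n1 : (N + k).+1%:R != 0 :> R by rewrite pnatr_eq0.
  apply: (mulfI n1); rewrite [LHS]mulrA h.
  move: n1; move: (_.+1%:R : R) => X X0.
  by field; rewrite X0 gt_eqF.
rewrite E; set r := 'C(N.*2, N + k)%:R / _ in IH1 IH2 r0 *.
have q1 : 1 - (N - k)%:R / (N + k).+1%:R <= (k%:R *+ 2 + 1) / N.+1%:R :> R.
  have -> : 1 - (N - k)%:R / (N + k).+1%:R = (k%:R *+ 2 + 1) / (N + k).+1%:R :> R.
    rewrite natrB ?(ltnW kN)// -addnS -addn1 !natrD.
    field.
    by rewrite natr1 -natrD pnatr_eq0 addnS.
  rewrite ler_wpM2l ?addr_ge0 ?mulrn_wge0// lef_pV2 ?posrE ?ltr0n//.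
  by rewrite ler_nat ltnS leq_addr.
have q0 : 0 <= 1 - (N - k)%:R / (N + k).+1%:R :> R.
  by rewrite subr_ge0 ler_pdivrMr ?ltr0n// mul1r ler_nat; lia.
have q2 : 0 <= (N - k)%:R / (N + k).+1%:R :> R by rewrite divr_ge0.
set s := (N - k)%:R / _ in q0 q1 q2 *.
split; last by rewrite mulr_ile1//; lra.
have : r * (1 - s) <= 1 - s by rewrite ler_piMl.
have -> : k.+1%:R ^+ 2 / N.+1%:R = k%:R ^+ 2 / N.+1%:R + (k%:R *+ 2 + 1) / N.+1%:R :> R.
  by rewrite -mulrDl -(natr1 k); congr (_ / _); ring.
move: IH1 q1; move: (k%:R ^+ 2 / N.+1%:R) ((k%:R *+ 2 + 1) / N.+1%:R) => X Y.
by clearbody r s; lra.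
Qed.

Variables (f : R -> R) (C : R).
Hypothesis C0 : 0 <= C.
Hypothesis cf : continuous f.
Hypothesis fC : forall u : R, 0 <= u -> `|f u| <= C * expR (- u).
Hypothesis fL : forall (m : nat) (u : R), 0 <= u -> `|u - m%:R| <= 2^-1 ->
  `|f u - f m%:R| <= C * expR (- m%:R) * `|u - m%:R|.

Definition cos_transform (k : R) :=
  \int[mu]_(u in `[0, +oo[) (f u * cos (2 * pi * k * u)).

Let F := cos_transform.
Let ccos (k : R) : continuous (fun u => cos (k * u)).
Proof. by move=> u; exact: is_derive_continuous. Qed.

Let cfc N : continuous (fun u : R => f u * cos (pi * u) ^+ N.*2).
Proof. by move=> u; apply: cvgM; [exact: cf|exact: continuous_cos_even]. Qed.

Let norm_cos_even N (u : R) : `|cos (pi * u) ^+ N.*2| <= 1.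
Proof. by rewrite normrX exprn_ile1 ?cos_max. Qed.

Let fcC N (u : R) : 0 <= u -> `|f u * cos (pi * u) ^+ N.*2| <= C * expR (- u).
Proof.
move=> u0; rewrite normrM; apply: le_trans (fC u0).
by rewrite ler_piMr ?norm_cos_even.
Qed.

Let S (M : nat) := f 0 / 2 + \sum_(m < M) f m.+1%:R.
Let T (N : nat) := F 0 + 2 * \sum_(k < N) F k.+1%:R.

(** One unit interval around each integer, except that 0 only has the right half
    of its interval: this is where the term f 0 / 2 comes from. *)
Lemma kernel_partial (N M : nat) :
  `|\int[mu]_(u in `[0, M%:R + 2^-1]) (f u * cos (pi * u) ^+ N.*2) - wallis R N * S M|
  <= C * (\sum_(m < M.+1) expR (- m%:R)) * (conc_rate R N * wallis R N).
Proof.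
elim: M => [|M IH].
  rewrite big_ord_recr !big_ord0 /S big_ord0 addr0 !add0r /=.
  rewrite (_ : wallis R N * (f 0 / 2) = f 0%:R * (wallis R N * (2^-1 - 0))); last first.
    by rewrite subr0 mulrCA mulrA.
  apply: (@cos_even_concentration _ f 0) => //.
  - by rewrite mulr_ge0 ?expR_ge0.
  - lra.
  - by rewrite mulr0 sin0 mulr0.
  - by have := cos_pi_half_odd R 0; rewrite add0r => ->; rewrite mul0r.
  - by move=> u /andP[u0 u2]; rewrite subr0 ger0_norm.
  - rewrite add0r => u /andP[u0 u2]; apply: (@fL 0) => //.
    by rewrite subr0 ger0_norm.
have -> : \int[mu]_(u in `[0, M.+1%:R + 2^-1]) (f u * cos (pi * u) ^+ N.*2) =
  \int[mu]_(u in `[0, M%:R + 2^-1]) (f u * cos (pi * u) ^+ N.*2) +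
  \int[mu]_(u in `[M%:R + 2^-1, M.+1%:R + 2^-1]) (f u * cos (pi * u) ^+ N.*2).
  rewrite -(@Rintegral_itv_obnd_cbnd _ (M%:R + 2^-1)); last first.
    have sub : `]M%:R + 2^-1, M.+1%:R + 2^-1]%classic `<=`
      (`[M%:R + 2^-1, M.+1%:R + 2^-1]%classic : set R).
      exact: subset_itv_oc_cc.
    apply: (@integrableS _ _ _ mu _ _ _ _ _ sub) => //.
    exact: continuous_itv_integrable.
  rewrite -(@Rintegral_itvB _ _ (BLeft 0) (BRight (M.+1%:R + 2^-1)) (M%:R + 2^-1)) ?bnd_simp.
  - by rewrite [RHS]addrC subrK.
  - exact: continuous_itv_integrable.
  - by rewrite addr_ge0.
  - by rewrite lerD2r ler_nat.
have -> : S M.+1 = S M + f M.+1%:R by rewrite /S big_ord_recr /= addrA.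
rewrite big_ord_recr /=.
set I1 := \int[mu]_(u in _) _ in IH *; set I2 := \int[mu]_(u in _) _.
rewrite [C * _]mulrDr mulrDl.
rewrite (_ : _ - _ = (I1 - wallis R N * S M) + (I2 - f M.+1%:R * (wallis R N * ((M.+1%:R + 2^-1) - (M%:R + 2^-1))))); last first.
  by rewrite -natr1; ring.
apply: (le_trans (ler_normD _ _)); apply: lerD; first exact: IH.
have MM : M%:R + 2^-1 = M.+1%:R - 2^-1 :> R by rewrite -natr1; field.
apply: cos_even_concentration => //.
- by rewrite mulr_ge0 ?expR_ge0.
- by rewrite ltrD2r ltr_nat.
- by rewrite -natr1; lra.
- by rewrite cos_pi_half_odd mul0r.
- by rewrite cos_pi_half_odd mul0r.
- move=> u; rewrite MM => /andP[u1 u2]; rewrite ler_norml; apply/andP; split; lra.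
- move=> u /andP[u1 u2]; apply: fL.
    by apply: le_trans u1; rewrite addr_ge0.
  by move: u1; rewrite MM => u1; rewrite ler_norml; apply/andP; split; lra.
Qed.

Let FN (k : R) : F (- k) = F k.
Proof.
by apply: eq_Rintegral => u _; rewrite mulrN mulNr cosN.
Qed.

Let I (N : nat) := \int[mu]_(u in `[0, +oo[) (f u * cos (pi * u) ^+ N.*2).

Lemma kernel_expansion (N : nat) :
  I N = (4 ^+ N)^-1 * \sum_(j < N.*2.+1) 'C(N.*2, j)%:R * F (j%:R - N%:R).
Proof.
pose h (j : nat) (u : R) := 'C(N.*2, j)%:R * (f u * cos (2 * pi * (j%:R - N%:R) * u)).
have mD : measurable (`[0, +oo[%classic : set R) by exact: measurable_itv.
have i1 (k : R) : mu.-integrable `[0, +oo[ (EFin \o (fun u => f u * cos (2 * pi * k * u))).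
  apply: (@integrable_le_expRN _ _ C).
    by move=> u; apply: cvgM; [exact: cf|exact: ccos].
  move=> u u0; rewrite normrM; apply: le_trans (fC u0).
  by rewrite ler_piMr// cos_max.
have ih j : mu.-integrable `[0, +oo[ (EFin \o h j).
  have -> : EFin \o h j =
    (fun u => (('C(N.*2, j)%:R)%:E * (f u * cos (2 * pi * (j%:R - N%:R) * u))%:E)%E).
    by apply/funext.
  by apply: integrableZl => //; exact: i1.
have isum : mu.-integrable `[0, +oo[ (EFin \o (fun u => \sum_(j < N.*2.+1) h j u)).
  have -> : EFin \o (fun u => \sum_(j < N.*2.+1) h j u) =
    (fun u => (\sum_(j < N.*2.+1) (h j u)%:E)%E).
    by apply/funext => u /=; rewrite sumEFin.
  by apply: integrable_sum => // j _; exact: ih.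
transitivity (\int[mu]_(u in `[0, +oo[) ((4 ^+ N)^-1 * \sum_(j < N.*2.+1) h j u)).
  apply: eq_Rintegral => u _.
  have e := expr_cos_sum (pi * u) N.*2.
  have n4 : (2 : R) ^+ N.*2 = 4 ^+ N by rewrite -mul2n exprM; congr (_ ^+ _); ring.
  have f0 : (4 : R) ^+ N != 0 by rewrite expf_neq0.
  rewrite exprMn n4 in e.
  rewrite (_ : cos (pi * u) ^+ N.*2 = (4 ^+ N)^-1 * (4 ^+ N * cos (pi * u) ^+ N.*2)); last by rewrite mulKf.
  rewrite e mulrCA; congr (_ * _); rewrite big_distrr /=; apply: eq_bigr => j _.
  rewrite /h mulrCA; congr (_ * (_ * cos _)).
  by move: (j : nat) => i; rewrite -muln2 natrM; ring.
rewrite RintegralZl// Rintegral_sum//; congr (_ * _); apply: eq_bigr => j _.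
by rewrite /h RintegralZl//; exact: i1.
Qed.

(** The frequencies k and -k have equal weights, and F is even. *)
Lemma kernel_expansion_fold (N : nat) :
  I N / wallis R N = F 0 + 2 * \sum_(k < N) 'C(N.*2, N + k.+1)%:R / 'C(N.*2, N)%:R * F k.+1%:R.
Proof.
have c0 : 'C(N.*2, N)%:R != 0 :> R by rewrite pnatr_eq0 -lt0n bin_gt0 -addnn leq_addr.
have f0 : (4 : R) ^+ N != 0 by rewrite expf_neq0.
set g := fun j : nat => 'C(N.*2, j)%:R * F (j%:R - N%:R).
have E : \sum_(j < N.*2.+1) g j = 'C(N.*2, N)%:R * F 0 +
   2 * \sum_(k < N) 'C(N.*2, N + k.+1)%:R * F k.+1%:R.
  rewrite -(big_mkord predT) (@big_cat_nat _ _ _ N) //=; last by lia.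
  have -> : \sum_(0 <= j < N) g j = \sum_(k < N) 'C(N.*2, N + k.+1)%:R * F k.+1%:R.
    rewrite big_nat_rev big_mkord; apply: eq_bigr => -[k kN] _ /=.
    rewrite /g add0n -bin_sub; last by lia.
    have -> : (N.*2 - (N - k.+1) = N + k.+1)%N by lia.
    by rewrite natrB// addrAC subrr sub0r FN.
  have -> : \sum_(N <= j < N.*2.+1) g j = \sum_(0 <= j < N.+1) g (j + N)%N.
    by rewrite -[X in \sum_(X <= _ < _) _]add0n big_addn; congr (\sum_(0 <= j < _) _); lia.
  rewrite big_mkord big_ord_recl /= {1}/g add0n subrr addrCA; congr (_ + _).
  rewrite mulr_natl mulr2n; congr (_ + _); apply: eq_bigr => k _.
  by rewrite /g /bump /= add1n [(_ + N)%N]addnC natrD addrAC subrr add0r.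
rewrite kernel_expansion E /wallis.
have -> : \sum_(k < N) 'C(N.*2, N + k.+1)%:R / 'C(N.*2, N)%:R * F k.+1%:R =
  ('C(N.*2, N)%:R)^-1 * \sum_(k < N) 'C(N.*2, N + k.+1)%:R * F k.+1%:R.
  by rewrite big_distrr /=; apply: eq_bigr => k _; rewrite mulrAC mulrC.
by field; rewrite c0 f0.
Qed.

Hypothesis FC : forall k : nat, k%:R ^+ 2 * `|F k%:R| <= C * expR (- k%:R).

(** The weight of F k differs from 1 by at most k^2 / (N+1), which the decay
    of k^2 F k makes summable. *)
Lemma kernel_dual (N : nat) : `|I N / wallis R N - T N| <= 4 * C / N.+1%:R.
Proof.
rewrite kernel_expansion_fold /T opprD addrACA subrr add0r -mulrBr -sumrB.
rewrite normrM (@ger0_norm _ 2)// -(mulrA 4) (_ : 4 = 2 * 2); last by ring.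
rewrite -mulrA ler_wpM2l//.
apply: (le_trans (ler_norm_sum _ _ _)).
apply: (@le_trans _ _ (\sum_(k < N) C / N.+1%:R * expR (- k.+1%:R))).
  apply: ler_sum => k _.
  have [r1 r2] := central_bin_ratio N k.+1.
  set r := 'C(N.*2, N + k.+1)%:R / _ in r1 r2 *.
  rewrite (_ : _ - _ = - (1 - r) * F k.+1%:R); last by ring.
  have r3 : 0 <= 1 - r by rewrite subr_ge0.
  rewrite normrM normrN (ger0_norm r3).
  apply: (@le_trans _ _ (k.+1%:R ^+ 2 / N.+1%:R * `|F k.+1%:R|)).
    by rewrite ler_wpM2r// lerBlDr addrC -lerBlDr.
  rewrite mulrAC [leRHS]mulrAC ler_wpM2r ?invr_ge0//; exact: FC.
rewrite -big_distrr /= [leRHS]mulrC ler_wpM2l ?divr_ge0//.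
apply: le_trans (sum_expRN_le2 N.+1).
by rewrite big_ord_recl /= lerDr expR_ge0.
Qed.

Lemma kernel_primal (N : nat) (l : R) : S M @[M --> \oo] --> l ->
  `|I N / wallis R N - l| <= 2 * C * conc_rate R N.
Proof.
move=> Sl; have w0 := wallis_gt0 R N.
have d0 := conc_rate_gt0 R N.
pose a M : R := `|I N / wallis R N - S M|.
pose b M : R := C / wallis R N * expR (- M%:R) + 2 * C * conc_rate R N.
have ab M : a M <= b M.
  have h1 := kernel_partial N M.
  have h2 : `|I N - \int[mu]_(u in `[0, M%:R + 2^-1]) (f u * cos (pi * u) ^+ N.*2)|
      <= C * expR (- (M%:R + 2^-1)).
    by apply: Rintegral_tail_le; [rewrite addr_ge0|exact: cfc|exact: fcC].
  set J := \int[mu]_(u in _) _ in h1 h2.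
  rewrite /a (_ : _ - _ = ((I N - J) + (J - wallis R N * S M)) / wallis R N); last first.
    by move: w0; move: (wallis R N) => w w0; field; rewrite gt_eqF.
  rewrite normrM (gtr0_norm (_ : 0 < (wallis R N)^-1)) ?invr_gt0//.
  rewrite ler_pdivrMr//; apply: (le_trans (ler_normD _ _)).
  rewrite /b mulrDl; apply: lerD.
    apply: (le_trans h2); rewrite [leRHS]mulrAC divfK ?gt_eqF//.
    by rewrite ler_wpM2l// ler_expR lerN2 lerDl.
  apply: (le_trans h1); rewrite -[leRHS]mulrA ler_wpM2r ?mulr_ge0 ?(ltW d0) ?(ltW w0)//.
  by rewrite mulrC ler_wpM2r// sum_expRN_le2.
have al : a M @[M --> \oo] --> `|I N / wallis R N - l|.
  by apply: cvg_norm; apply: cvgB => //; exact: cvg_cst.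
have bl : b M @[M --> \oo] --> 2 * C * conc_rate R N.
  rewrite -[X in _ --> X]add0r -[X in _ --> X + _](mulr0 (C / wallis R N)).
  by apply: cvgD; [apply: cvgMr; exact: cvgn_expR|exact: cvg_cst].
apply: (ler_cvg_to al bl); exact: nearW.
Qed.

(** Both sums are within O(N^(-1/2)) of the same normalised integral
    I N / wallis N. Only the convergence of one of them is assumed. *)
Lemma half_line_poisson (l : R) : S M @[M --> \oo] --> l -> T N @[N --> \oo] --> l.
Proof.
move=> Sl.
have dl : conc_rate R N @[N --> \oo] --> (0 : R).
  rewrite -sqrtr0; apply: continuous_cvg; first exact: sqrt_continuous.
  exact: cvg_harmonic.
apply/subr_cvg0; apply: norm_cvg0.
apply: (@squeeze_cvgr _ _ _ _ (cst 0) (fun N => 6 * C * conc_rate R N)).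
- near=> N; rewrite normr_ge0/=.
  have h1 := kernel_primal N Sl; have h2 := kernel_dual N.
  rewrite (_ : _ - _ = - (I N / wallis R N - T N) + (I N / wallis R N - l)); last by ring.
  apply: (le_trans (ler_normD _ _)); rewrite normrN.
  have h3 : N.+1%:R^-1 <= conc_rate R N.
    rewrite -[leLHS](sqr_sqrtr (_ : 0 <= N.+1%:R^-1)) ?invr_ge0//.
    rewrite -/(conc_rate R N) expr2 ler_piMl// ?sqrtr_ge0//.
    by rewrite -sqrtr1 ler_sqrt// invf_le1// ler1n.
  have h4 : 4 * C / N.+1%:R <= 4 * C * conc_rate R N by rewrite ler_wpM2l// mulr_ge0.
  apply: (le_trans (lerD (le_trans h2 h4) h1)).
  by rewrite -!mulrDl le_eqVlt; apply/orP; left; apply/eqP; ring.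
- exact: cvg_cst.
- by rewrite -[X in _ --> X](mulr0 (6 * C)); apply: cvgMr.
Unshelve. all: by end_near. Qed.

End Poisson.

(** * The functional equation of omega *)

Section OmegaFunctionalEquation.
Variable R : realType.
Notation mu := (@lebesgue_measure R).

Definition omega_term (x u : R) : R :=
  (2 * pi ^+ 2 * u ^+ 4 * x ^+ 2 - 3 * pi * u ^+ 2 * x) * expR (- (pi * u ^+ 2 * x)).

Lemma omega_termE (x u : R) : omega_term x u =
  2 * pi ^+ 2 * x ^+ 2 * (u ^+ 4 * expR (- (pi * x * u ^+ 2)))
  - 3 * pi * x * (u ^+ 2 * expR (- (pi * x * u ^+ 2))).
Proof. by rewrite /omega_term (mulrAC pi); ring. Qed.

Lemma is_derive_omega_term (x u : R) : is_derive u 1 (omega_term x)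
  (- (4 * pi ^+ 3 * x ^+ 3) * (u ^+ 5 * expR (- (pi * x * u ^+ 2)))
   + 14 * pi ^+ 2 * x ^+ 2 * (u ^+ 3 * expR (- (pi * x * u ^+ 2)))
   - 6 * pi * x * (u ^+ 1 * expR (- (pi * x * u ^+ 2)))).
Proof.
rewrite /omega_term; apply: trigger_derive; rewrite /GRing.scale /= (mulrAC pi x).
by move: (@pi R) (expR _) => P e; ring.
Qed.

Lemma continuous_omega_term (x : R) : continuous (omega_term x).
Proof. by move=> u; exact: (is_derive_continuous (is_derive_omega_term x u)). Qed.

(** The factor e is more than enough for passing from the intermediate point of the
    mean value theorem, at distance at most 1/2 from m, to m itself. *)
Lemma lipschitz_le_expRN (f df : R -> R) (B : R) (m : nat) (u : R) :
  (forall v : R, is_derive v 1 f (df v)) ->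
  (forall v : R, 0 <= v -> `|df v| <= B * expR (- v)) ->
  0 <= u -> `|u - m%:R| <= 2^-1 ->
  `|f u - f m%:R| <= B * expR 1 * expR (- m%:R) * `|u - m%:R|.
Proof.
move=> d dB u0 um.
have B0 : 0 <= B by have := dB 0 (lexx 0); rewrite oppr0 expR0 mulr1; apply: le_trans.
have key (v : R) : 0 <= v -> m%:R - 2^-1 <= v ->
    `|df v| <= B * expR 1 * expR (- m%:R).
  move=> v0 mv; apply: (le_trans (dB _ v0)).
  rewrite -mulrA -expRD ler_wpM2l// ler_expR; lra.
have cf : continuous f by move=> v; exact: (is_derive_continuous (d v)).
have [um'|mu'] := leP u m%:R.
  have [c /[!in_itv]/= /andP[c1 c2] E] := MVT_segment um' (fun v _ => d v) (continuous_subspaceT cf).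
  rewrite distrC E normrM [`|_ - u|]distrC ler_wpM2r// key//.
    exact: le_trans c1.
  by move: um; rewrite ler_norml => /andP[h _]; lra.
have [c /[!in_itv]/= /andP[c1 c2] E] := MVT_segment (ltW mu') (fun v _ => d v) (continuous_subspaceT cf).
rewrite E normrM ler_wpM2r// key//.
  exact: le_trans c1.
lra.
Qed.

(** One constant for all the hypotheses of half_line_poisson. The second bound
    is for the dual side, where the transform of omega_term x is a multiple
    of omega_term (1/x). *)
Lemma omega_term_decay (x : R) : 0 < x -> exists C : R, [/\ 0 <= C,
  (forall u : R, 0 <= u -> `|omega_term x u| <= C * expR (- u)),
  (forall u : R, 0 <= u -> u ^+ 2 * `|omega_term x u| <= C * expR (- u)) &
  (forall (m : nat) (u : R), 0 <= u -> `|u - m%:R| <= 2^-1 ->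
  `|omega_term x u - omega_term x m%:R| <= C * expR (- m%:R) * `|u - m%:R|)].
Proof.
move=> x0; have pi0 := @pi_gt0 R.
have px0 : 0 < pi * x by rewrite mulr_gt0.
pose K (j : nat) : R := j`!%:R * expR (pi * x)^-1.
have K0 j : 0 <= K j by rewrite mulr_ge0 ?expR_ge0.
have mo j (u : R) : 0 <= u -> u ^+ j * expR (- (pi * x * u ^+ 2)) <= K j * expR (- u).
  by move=> u0; exact: gauss_moment_le.
have mo0 j (u : R) : 0 <= u -> 0 <= u ^+ j * expR (- (pi * x * u ^+ 2)).
  by move=> u0; rewrite mulr_ge0 ?exprn_ge0 ?expR_ge0.
have comb (a b p q P Q e : R) : 0 <= a -> 0 <= b -> 0 <= p -> 0 <= q ->
    p <= P * e -> q <= Q * e -> `|a * p - b * q| <= (a * P + b * Q) * e.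
  move=> a0 b0 p0 q0 pP qQ; apply: (le_trans (ler_normB _ _)).
  rewrite !ger0_norm ?mulr_ge0// mulrDl -!mulrA.
  by apply: lerD; apply: ler_wpM2l.
have comb3 (c a b r p q C P Q e : R) : 0 <= c -> 0 <= a -> 0 <= b ->
    0 <= r -> 0 <= p -> 0 <= q -> r <= C * e -> p <= P * e -> q <= Q * e ->
    `|- c * r + a * p - b * q| <= (c * C + (a * P + b * Q)) * e.
  move=> c0 a0 b0 r0 p0 q0 rC pP qQ.
  rewrite -addrA mulrDl; apply: (le_trans (ler_normD _ _)); apply: lerD.
    by rewrite mulNr normrN ger0_norm ?mulr_ge0// -mulrA ler_wpM2l.
  exact: comb.
have a0 : 0 <= 2 * pi ^+ 2 * x ^+ 2 by rewrite !mulr_ge0 ?exprn_ge0 ?ltW.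
have b0 : 0 <= 3 * pi * x by rewrite !mulr_ge0 ?ltW.
pose C1 := 2 * pi ^+ 2 * x ^+ 2 * K 4 + 3 * pi * x * K 2.
pose C2 := 2 * pi ^+ 2 * x ^+ 2 * K 6 + 3 * pi * x * K 4.
pose C3 := 4 * pi ^+ 3 * x ^+ 3 * K 5 + (14 * pi ^+ 2 * x ^+ 2 * K 3 + 6 * pi * x * K 1).
have C10 : 0 <= C1 by exact: addr_ge0 (mulr_ge0 a0 (K0 4%N)) (mulr_ge0 b0 (K0 2%N)).
have C20 : 0 <= C2 by exact: addr_ge0 (mulr_ge0 a0 (K0 6%N)) (mulr_ge0 b0 (K0 4%N)).
have c0 : 0 <= 4 * pi ^+ 3 * x ^+ 3 by rewrite !mulr_ge0 ?exprn_ge0 ?ltW.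
have d0 : 0 <= 14 * pi ^+ 2 * x ^+ 2 by rewrite !mulr_ge0 ?exprn_ge0 ?ltW.
have e0 : 0 <= 6 * pi * x by rewrite !mulr_ge0 ?ltW.
have C30 : 0 <= C3.
  exact: addr_ge0 (mulr_ge0 c0 (K0 5%N)) (addr_ge0 (mulr_ge0 d0 (K0 3%N))
    (mulr_ge0 e0 (K0 1%N))).
have e3 : 0 <= C3 * expR 1 by exact: mulr_ge0 C30 (expR_ge0 1).
have [h1 h2 h3 h4] : [/\ C1 <= C1 + C2 + C3 * expR 1, C2 <= C1 + C2 + C3 * expR 1,
    C3 * expR 1 <= C1 + C2 + C3 * expR 1 & 0 <= C1 + C2 + C3 * expR 1].
  by move: C10 C20 e3; move: C1 C2 (C3 * expR 1) => r1 r2 r3; split; lra.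
exists (C1 + C2 + C3 * expR 1); split.
- exact: h4.
- move=> u u0; apply: (@le_trans _ _ (C1 * expR (- u))); last first.
    exact: ler_wpM2r (expR_ge0 _) _ _ h1.
  by rewrite omega_termE; exact: comb a0 b0 (mo0 _ _ u0) (mo0 _ _ u0) (mo _ _ u0) (mo _ _ u0).
- move=> u u0; apply: (@le_trans _ _ (C2 * expR (- u))); last first.
    exact: ler_wpM2r (expR_ge0 _) _ _ h2.
  rewrite -[u ^+ 2]ger0_norm ?exprn_ge0// -normrM.
  have -> : u ^+ 2 * omega_term x u =
      2 * pi ^+ 2 * x ^+ 2 * (u ^+ 6 * expR (- (pi * x * u ^+ 2)))
      - 3 * pi * x * (u ^+ 4 * expR (- (pi * x * u ^+ 2))).
    by rewrite omega_termE; ring.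
  exact: comb a0 b0 (mo0 _ _ u0) (mo0 _ _ u0) (mo _ _ u0) (mo _ _ u0).
- move=> m u u0 um.
  apply: (@le_trans _ _ (C3 * expR 1 * expR (- m%:R) * `|u - m%:R|)).
    apply: (lipschitz_le_expRN (is_derive_omega_term x)) => // v v0.
    exact: comb3 c0 d0 e0 (mo0 _ _ v0) (mo0 _ _ v0) (mo0 _ _ v0)
      (mo _ _ v0) (mo _ _ v0) (mo _ _ v0).
  by rewrite ler_wpM2r//; exact: ler_wpM2r (expR_ge0 _) _ _ h3.
Qed.

(** Orders 2 and 4 carry the phases pi and 2 pi, hence opposite signs, and the
    constant terms of the two Hermite polynomials cancel. *)
Lemma cos_transform_omega_term (x k : R) : 0 < x ->
  cos_transform (omega_term x) k = (2 * Num.sqrt x)^-1 * omega_term x^-1 k.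
Proof.
move=> x0; have pi0 := @pi_gt0 R.
have px0 : 0 < pi * x by rewrite mulr_gt0.
pose s := 2 * pi * k.
have E : cos_transform (omega_term x) k =
  2 * pi ^+ 2 * x ^+ 2 * gauss_fourier (pi * x) 4 s
  + 3 * pi * x * gauss_fourier (pi * x) 2 s.
  have i j : mu.-integrable `[0, +oo[ (EFin \o gauss_osc (pi * x) j s).
    exact: integrable_gauss_osc.
  have iZ j c : mu.-integrable `[0, +oo[ (EFin \o (fun u => c * gauss_osc (pi * x) j s u)).
    have -> : EFin \o (fun u => c * gauss_osc (pi * x) j s u) =
      (fun u => (c%:E * (gauss_osc (pi * x) j s u)%:E)%E) by apply/funext.
    by apply: integrableZl; [exact: measurable_itv|exact: i].
  rewrite -!RintegralZl// -RintegralD//.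
  apply: eq_Rintegral => u _; rewrite omega_termE /gauss_osc.
  have -> : s * u + 4 * (pi / 2) = s * u + pi *+ 2 by rewrite mulr2n; field.
  have -> : s * u + 2 * (pi / 2) = s * u + pi by field.
  by rewrite cosD2pi cosDpi /s; ring.
have sx0 : 0 < Num.sqrt x by rewrite sqrtr_gt0.
have sp0 : 0 < Num.sqrt pi :> R by rewrite sqrtr_gt0.
rewrite E gauss_fourier4// gauss_fourier2// gauss_fourier0//.
rewrite sqrtrM ?(ltW pi0)// /omega_term.
have -> : s ^+ 2 / (4 * (pi * x)) = pi * k ^+ 2 * x^-1.
  by rewrite /s; move: pi0; move: (@pi R) => P P0; field; rewrite !gt_eqF.
rewrite /s; move: sp0 pi0 {px0 E s}.
move: (Num.sqrt (pi : R)) (expR _) => sp e sp0; move: (@pi R) => P P0.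
by field; rewrite !gt_eqF.
Qed.

Lemma cvg_omega (x : R) : 0 < x ->
  \sum_(m < n) omega_term x m.+1%:R @[n --> \oo] --> omega x.
Proof.
move=> x0; have [C [C0 hC _ _]] := omega_term_decay x0.
have cS : cvgn (series (fun m => omega_term x m.+1%:R)).
  apply: normed_cvg; rewrite /normed_series_of /=.
  apply: (@nondecreasing_is_cvgn R).
    by apply: nondecreasing_series => n _ _; exact: normr_ge0.
  exists (2 * C) => _ [n _ <-].
  rewrite /series /= big_mkord.
  apply: (@le_trans _ _ (\sum_(m < n) C * expR (- m.+1%:R))).
    by apply: ler_sum => m _; apply: hC.
  rewrite -big_distrr /= mulrC ler_wpM2r//.
  apply: le_trans (sum_expRN_le2 R n.+1).
  by rewrite big_ord_recl /= lerDr expR_ge0.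
have E : (fun n => \sum_(m < n) omega_term x m.+1%:R) = series (fun m => omega_term x m.+1%:R).
  by apply/funext => n; rewrite /series /= big_mkord.
have E2 : (fun n => \sum_(1 <= m < n.+1) omega_term x m%:R) = series (fun m => omega_term x m.+1%:R).
  by apply/funext => n; rewrite /series /= big_add1.
rewrite E; rewrite (_ : omega x = limn (series (fun m => omega_term x m.+1%:R))); first exact: cS.
(* omega sums from m = 1, the series from 0 with the index shifted *)
rewrite /omega; apply/cvg_lim => //.
by rewrite -cvg_shiftS /= E2; exact: cS.
Qed.

(** As omega_term vanishes at 0, neither side of the Poisson formula has a term
    at 0. *)
Lemma omega_inv (x : R) : 0 < x -> omega x = (Num.sqrt x)^-1 * omega x^-1.
Proof.
move=> x0; have [C [C0 hC _ hL]] := omega_term_decay x0.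
have y0 : 0 < x^-1 by rewrite invr_gt0.
have sx0 : 0 < Num.sqrt x by rewrite sqrtr_gt0.
have [D [D0 _ hD _]] := omega_term_decay y0.
set F := cos_transform (omega_term x).
have FE k : F k = (2 * Num.sqrt x)^-1 * omega_term x^-1 k by exact: cos_transform_omega_term.
have i0 : 0 <= (2 * Num.sqrt x)^-1 by rewrite invr_ge0 mulr_ge0 ?sqrtr_ge0.
have ot0 z : omega_term z 0 = 0 by rewrite /omega_term !expr0n /= !(mulr0, mul0r) subrr mul0r.
pose B := C + (2 * Num.sqrt x)^-1 * D.
have B0 : 0 <= B by rewrite addr_ge0 ?mulr_ge0.
have CB : C <= B by rewrite lerDl mulr_ge0.
have := @half_line_poisson R (omega_term x) B B0 (@continuous_omega_term x).
move=> /(_ _ _ _ (omega x)) H.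
have {}H : F 0 + 2 * (\sum_(k < N) F k.+1%:R) @[N --> \oo] --> omega x.
  apply: H.
  - by move=> u u0; apply: (le_trans (hC u u0)); rewrite ler_wpM2r ?expR_ge0.
  - move=> m u u0 um; apply: (le_trans (hL m u u0 um)).
    by rewrite ler_wpM2r// ler_wpM2r ?expR_ge0.
  - move=> k; rewrite -/(F _) FE normrM (ger0_norm i0) mulrCA.
    apply: (@le_trans _ _ ((2 * Num.sqrt x)^-1 * (D * expR (- k%:R)))).
      by rewrite ler_wpM2l// hD.
    by rewrite mulrA ler_wpM2r ?expR_ge0// lerDr.
  - rewrite ot0 mul0r; under eq_fun do rewrite add0r.
    exact: cvg_omega.
have H2 : F 0 + 2 * (\sum_(k < N) F k.+1%:R) @[N --> \oo] --> (Num.sqrt x)^-1 * omega x^-1.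
  have -> : (fun N => F 0 + 2 * (\sum_(k < N) F k.+1%:R)) =
    (fun N => (Num.sqrt x)^-1 * \sum_(k < N) omega_term x^-1 k.+1%:R).
    apply/funext => N; rewrite FE ot0 mulr0 add0r.
    under eq_bigr do rewrite FE.
    by rewrite -big_distrr /=; field; rewrite gt_eqF.
  by apply: cvgMr; exact: cvg_omega.
exact: (cvg_unique _ H H2).
Qed.

End OmegaFunctionalEquation.

(** * Envelopes of the integrand *)

Section Integrand.
Variable R : realType.
Notation mu := (@lebesgue_measure R).

Lemma omega_term_ge0 (x u : R) : 1 <= x -> 1 <= u -> 0 <= omega_term x u.
Proof.
move=> x1 u1; have pi2 := @pi_ge2 R.
rewrite /omega_term mulr_ge0 ?expR_ge0//.
have u2 : 1 <= u ^+ 2 by rewrite exprn_ege1.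
have p0 : 0 <= pi * u ^+ 2 * x by rewrite !mulr_ge0 ?sqr_ge0//; lra.
have -> : 2 * pi ^+ 2 * u ^+ 4 * x ^+ 2 - 3 * pi * u ^+ 2 * x =
  (pi * u ^+ 2 * x) * (2 * (pi * u ^+ 2 * x) - 3) by ring.
rewrite mulr_ge0// subr_ge0.
have : 2 * 1 * 1 <= pi * u ^+ 2 * x by rewrite !ler_pM// ?mulr_ge0//; lra.
lra.
Qed.

(** For x >= 1 and m >= 2 the exponent m^2 x is at least m^2 - 2 + 2 x, which
    separates a factor e^(-2 pi x) from a summable function of m. *)
Lemma omega_term_tail : exists S : R, 0 <= S /\
  forall (x : R) (m : nat), 1 <= x -> (1 < m)%N ->
    omega_term x m%:R <= S * x ^+ 2 * expR (- (2 * pi * x)) * expR (- m%:R).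
Proof.
have pi0 := @pi_gt0 R.
pose S := 2 * pi ^+ 2 * expR (2 * pi) * (4`!%:R * expR pi^-1) : R.
exists S; split; first by rewrite !mulr_ge0 ?expR_ge0 ?(ltW pi0).
move=> x m x1 m2.
have x0 : 0 <= x by apply: le_trans x1.
have mR : 2 <= m%:R :> R by rewrite ler_nat.
have m0 : 0 <= m%:R :> R by [].
have mm2 : 2 <= m%:R ^+ 2 :> R.
  by apply: (@le_trans _ _ (2 * 1)); [rewrite mulr1|rewrite expr2 ler_pM//; lra].
rewrite /omega_term.
have e1 : expR (- (pi * m%:R ^+ 2 * x)) <=
    expR (- (2 * pi * x)) * (expR (2 * pi) * expR (- (pi * m%:R ^+ 2))).
  rewrite -!expRD ler_expR -subr_ge0.
  rewrite (_ : _ - _ = pi * (m%:R ^+ 2 - 2) * (x - 1)); last by ring.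
  by rewrite !mulr_ge0 ?(ltW pi0)// subr_ge0.
have e2 := gauss_moment_le 4 pi0 m0.
apply: (@le_trans _ _ (2 * pi ^+ 2 * m%:R ^+ 4 * x ^+ 2 * expR (- (pi * m%:R ^+ 2 * x)))).
  rewrite ler_wpM2r ?expR_ge0// gerBl !mulr_ge0 ?sqr_ge0 ?(ltW pi0)//.
apply: (@le_trans _ _ (2 * pi ^+ 2 * m%:R ^+ 4 * x ^+ 2 *
    (expR (- (2 * pi * x)) * (expR (2 * pi) * expR (- (pi * m%:R ^+ 2)))))).
  by rewrite ler_wpM2l// !mulr_ge0 ?exprn_ge0 ?(ltW pi0).
have -> : 2 * pi ^+ 2 * m%:R ^+ 4 * x ^+ 2 *
    (expR (- (2 * pi * x)) * (expR (2 * pi) * expR (- (pi * m%:R ^+ 2)))) =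
  (2 * pi ^+ 2 * expR (2 * pi) * x ^+ 2 * expR (- (2 * pi * x))) *
  (m%:R ^+ 4 * expR (- (pi * m%:R ^+ 2))) by ring.
have -> : S * x ^+ 2 * expR (- (2 * pi * x)) * expR (- m%:R) =
  (2 * pi ^+ 2 * expR (2 * pi) * x ^+ 2 * expR (- (2 * pi * x))) *
  (4`!%:R * expR pi^-1 * expR (- m%:R)).
  by rewrite /S; move: (4`!%:R) => z; ring.
by rewrite ler_wpM2l// !mulr_ge0 ?exprn_ge0 ?expR_ge0 ?(ltW pi0).
Qed.

Let cvg_omegaS (x : R) : 1 <= x ->
  \sum_(m < n.+1) omega_term x m.+1%:R @[n --> \oo] --> omega x.
Proof.
by move=> x1; have := cvg_omega (lt_le_trans ltr01 x1); rewrite -cvg_shiftS.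
Qed.

Lemma omega_ge_first (x : R) : 1 <= x -> omega_term x 1 <= omega x.
Proof.
move=> x1; apply: (ler_cvg_to (cvg_cst (omega_term x 1)) (cvg_omegaS x1)).
apply: nearW => n; rewrite big_ord_recl /= lerDl sumr_ge0// => m _.
by apply: omega_term_ge0 => //; rewrite ler1n.
Qed.

Lemma omega_le : exists S : R, 0 <= S /\ forall x : R, 1 <= x ->
  omega x <= 2 * pi ^+ 2 * x ^+ 2 * expR (- (pi * x))
    + S * x ^+ 2 * expR (- (2 * pi * x)).
Proof.
have [S [S0 hS]] := omega_term_tail.
have pi0 := @pi_gt0 R.
exists (S * 2); split; first by rewrite mulr_ge0.
move=> x x1; have x0 : 0 < x by exact: lt_le_trans x1.
apply: (ler_cvg_to (cvg_omegaS x1) (cvg_cst _)); apply: nearW => n.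
rewrite big_ord_recl /=; apply: lerD.
  rewrite /omega_term !expr1n !mulr1 ler_wpM2r ?expR_ge0// gerBl.
  by rewrite !mulr_ge0 ?(ltW pi0) ?(ltW x0).
have C0 : 0 <= S * x ^+ 2 * expR (- (2 * pi * x)).
  by rewrite !mulr_ge0 ?expR_ge0 ?(ltW x0).
apply: (@le_trans _ _ (\sum_(m < n)
    S * x ^+ 2 * expR (- (2 * pi * x)) * expR (- m.+2%:R))).
  by apply: ler_sum => m _; exact: hS.
rewrite -big_distrr /=.
have -> : S * 2 * x ^+ 2 * expR (- (2 * pi * x)) =
  S * x ^+ 2 * expR (- (2 * pi * x)) * 2 by ring.
rewrite ler_wpM2l//; apply: le_trans (sum_expRN_le2 R n.+2).
by rewrite !big_ord_recl /= addrA lerDr addr_ge0 ?expR_ge0.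
Qed.

Lemma powR32 (x : R) : 0 < x -> x `^ (3 / 2) = x * Num.sqrt x.
Proof.
move=> x0; have -> : 3 / 2 = 1 + 2^-1 :> R by field.
rewrite powRD; last by rewrite gt_eqF ?implybT.
by rewrite powRr1 ?powR12_sqrt ?ltW.
Qed.

Definition coef_integrand (n : nat) (x : R) : R :=
  omega x / (x + 1) `^ (3 / 2) * ((x - 1) / (x + 1)) ^+ n.

(** The substitution x -> 1/x changes the sign of (x-1)/(x+1): evenness of the
    exponent matters. *)
Lemma coef_integrand_inv (n : nat) (x : R) : 0 < x ->
  coef_integrand (2 * n) x = x^-1 ^+ 2 * coef_integrand (2 * n) x^-1.
Proof.
move=> x0; have y0 : 0 < x^-1 by rewrite invr_gt0.
rewrite /coef_integrand omega_inv// !powR32 ?addr_gt0//.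
have -> : Num.sqrt (x + 1) = Num.sqrt (x^-1 + 1) * Num.sqrt x.
  by rewrite -sqrtrM ?addr_ge0 ?ltW// mulrDl mulVf ?gt_eqF// mul1r addrC.
have -> : ((x - 1) / (x + 1)) ^+ (2 * n) = ((x^-1 - 1) / (x^-1 + 1)) ^+ (2 * n).
  rewrite !exprM; congr (_ ^+ _).
  have x1 : x + 1 != 0 by rewrite gt_eqF ?addr_gt0.
  by field; rewrite ?x1 ?gt_eqF// addr_gt0.
have s0 : Num.sqrt x != 0 by rewrite gt_eqF ?sqrtr_gt0.
have t0 : Num.sqrt (x^-1 + 1) != 0 by rewrite gt_eqF ?sqrtr_gt0 ?addr_gt0.
move: (_ ^+ (2 * n)) (omega x^-1) => q w.
have xx : x = Num.sqrt x ^+ 2 by rewrite sqr_sqrtr// ltW.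
move: (Num.sqrt (x^-1 + 1)) t0 => t t0.
move: (Num.sqrt x) s0 xx => s s0 xx; rewrite xx.
have s1 : s ^+ 2 + 1 != 0 by rewrite gt_eqF// ltr_wpDl ?sqr_ge0.
by field; rewrite s0 t0 addrC s1.
Qed.

(** The kernels are permuted by the involution that preserves the integrand. *)
Lemma bessel_ker_inv (i j : nat) (a b x : R) : 0 < x -> (i + j = 3)%N ->
  x^-1 ^+ 2 * bessel_ker i a b x^-1 = bessel_ker j b a x.
Proof.
move=> x0 ij; rewrite /bessel_ker sqrtrV ?ltW//.
have -> : a * x^-1 + b / x^-1 = b * x + a / x by rewrite invrK addrC.
have s0 : Num.sqrt x != 0 by rewrite gt_eqF ?sqrtr_gt0.
rewrite invrK !mulrA; congr (_ * _).
have -> : i = (3 - j)%N by lia.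
have j3 : (j <= 3)%N by lia.
have xx : x = Num.sqrt x ^+ 2 by rewrite sqr_sqrtr// ltW.
move: (Num.sqrt x) s0 xx => s s0 xx; rewrite xx.
by case: j j3 {ij} => [|[|[|[|]]]]//= _; field.
Qed.

Lemma mobius_le_expRN (t : R) : 0 <= t -> (1 - t) / (1 + t) <= expR (- (2 * t)).
Proof.
move=> t0.
pose f (t : R) := (1 + t) * expR (- t) - (1 - t) * expR t.
have df (u : R) : is_derive u 1 f (u * (expR u - expR (- u))).
  by apply: trigger_derive; rewrite /GRing.scale /=; ring.
have : f 0 <= f t.
  have cf : continuous f by move=> u; exact: is_derive_continuous.
  have [c /[!in_itv]/= /andP[c1 c2] E] := MVT_segment t0 (fun v _ => df v) (continuous_subspaceT cf).
  rewrite -subr_ge0 E subr0 !mulr_ge0// subr_ge0 ler_expR; lra.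
rewrite {1}/f oppr0 expR0 addr0 subrr /f subr_ge0 => h.
rewrite ler_pdivrMr ?ltr_wpDr//.
have -> : expR (- (2 * t)) * (1 + t) = (1 + t) * expR (- t) * expR (- t).
  by rewrite -mulrA -expRD mulrC; congr (_ * expR _); ring.
by rewrite -ler_pdivrMr ?expR_gt0// [in X in X^-1]expRN invrK.
Qed.

Lemma expR_ge_taylor2 (s : R) : 0 <= s -> 1 + s + s ^+ 2 / 2 <= expR s.
Proof.
move=> s0; pose f (s : R) := expR s - (1 + s + s ^+ 2 / 2).
have df (u : R) : is_derive u 1 f (expR u - (1 + u)).
  by apply: trigger_derive; rewrite /GRing.scale /=; field.
have cf : continuous f by move=> u; exact: is_derive_continuous.
have [c /[!in_itv]/= /andP[c1 c2] E] := MVT_segment s0 (fun v _ => df v) (continuous_subspaceT cf).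
have : f 0 <= f s by rewrite -subr_ge0 E subr0 mulr_ge0// subr_ge0 expR_ge1Dx.
rewrite /f expR0; lra.
Qed.

(** With t = 1/x this is the only loss in replacing ((x-1)/(x+1))^(2n) by
    e^(-4n/x), and the exponent 3 is what makes it negligible where x is of
    order sqrt n. *)
Lemma mobius_ge_expRN (t : R) : 0 <= t -> t <= 1 ->
  (1 - 2 * t ^+ 3) * expR (- (2 * t)) <= (1 - t) / (1 + t).
Proof.
move=> t0 t1; have t2 : 0 <= 2 * t by rewrite mulr_ge0.
have e2 := expR_ge_taylor2 t2.
rewrite ler_pdivlMr ?ltr_wpDr// mulrAC -ler_pdivlMr ?expR_gt0// expRN invrK.
apply: (@le_trans _ _ ((1 - t) * (1 + 2 * t + (2 * t) ^+ 2 / 2))); last first.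
  by rewrite ler_wpM2l// subr_ge0.
rewrite -subr_ge0 (_ : _ - _ = 2 * t ^+ 4); last by field.
by rewrite mulr_ge0 ?exprn_ge0.
Qed.

Lemma coef_integrand_ge0 (n : nat) (x : R) : 1 <= x -> 0 <= coef_integrand n x.
Proof.
move=> x1; have x0 : 0 < x by exact: lt_le_trans x1.
rewrite mulr_ge0 ?exprn_ge0 ?divr_ge0 ?powR_ge0 ?subr_ge0 ?addr_ge0 ?(ltW x0)//.
by apply: le_trans (omega_ge_first x1); exact: omega_term_ge0.
Qed.

Lemma coef_integrand_le (S : R) (n : nat) (x : R) : 1 <= x ->
  omega x <= 2 * pi ^+ 2 * x ^+ 2 * expR (- (pi * x))
    + S * x ^+ 2 * expR (- (2 * pi * x)) ->
  coef_integrand (2 * n) x <= 2 * pi ^+ 2 * bessel_ker 0 pi (4 * n%:R) x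
    + S * bessel_ker 0 (2 * pi) (4 * n%:R) x.
Proof.
move=> x1 ho; have x0 : 0 < x by exact: lt_le_trans x1.
have s0 : 0 < Num.sqrt x by rewrite sqrtr_gt0.
have x10 : 0 < x + 1 by rewrite addr_gt0.
have q0 : 0 <= (x - 1) / (x + 1) by rewrite divr_ge0 ?subr_ge0// ltW.
have q1 : ((x - 1) / (x + 1)) ^+ (2 * n) <= expR (- (4 * n%:R / x)).
  have t0 : 0 <= x^-1 by rewrite invr_ge0 ltW.
  have := mobius_le_expRN t0.
  have -> : (1 - x^-1) / (1 + x^-1) = (x - 1) / (x + 1).
    have x1n : 1 + x != 0 by rewrite addrC gt_eqF.
    by field; rewrite addrC x1n gt_eqF.
  move=> h; apply: (@le_trans _ _ (expR (- (2 * x^-1)) ^+ (2 * n))).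
    by apply: lerXn2r => //; rewrite nnegrE ?expR_ge0.
  rewrite -expRM_natr ler_expR natrM.
  by rewrite le_eqVlt; apply/orP; left; apply/eqP; ring.
have p1 : x * Num.sqrt x <= (x + 1) `^ (3 / 2).
  rewrite powR32// ler_pM ?(ltW x0) ?(ltW s0) ?lerDl// ler_sqrt ?(ltW x10)//.
  by rewrite lerDl.
have xs0 : 0 < x * Num.sqrt x by rewrite mulr_gt0.
have o0 : 0 <= omega x by apply: le_trans (omega_ge_first x1); exact: omega_term_ge0.
set B := _ + _ in ho.
apply: (@le_trans _ _ (B / (x * Num.sqrt x) * expR (- (4 * n%:R / x)))).
  rewrite /coef_integrand ler_pM ?(exprn_ge0 _ q0)//.
    by rewrite divr_ge0 ?powR_ge0.
  rewrite ler_pM ?invr_ge0 ?powR_ge0// lef_pV2 ?posrE//.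
  exact: lt_le_trans p1.
rewrite /B /bessel_ker !expr0 !mulr1 !opprD !expRD.
have xx : x = Num.sqrt x ^+ 2 by rewrite sqr_sqrtr// ltW.
have sx : x ^+ 2 / (x * Num.sqrt x) = Num.sqrt x.
  move: (Num.sqrt x) s0 xx => s s0 xx; rewrite xx; field; rewrite gt_eqF//.
rewrite le_eqVlt; apply/orP; left; apply/eqP.
rewrite -[in RHS]sx.
by ring.
Qed.

Lemma expr_onem_ge (c : R) (k : nat) : 0 <= c -> c <= 1 -> 1 - k%:R * c <= (1 - c) ^+ k.
Proof.
move=> c0 c1; elim: k => [|k IH]; first by rewrite mul0r subr0 expr0.
rewrite exprSr; apply: (@le_trans _ _ ((1 - k%:R * c) * (1 - c))).
  rewrite -subr_ge0 -natr1 (_ : _ - _ = k%:R * c ^+ 2); last by ring.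
  by rewrite mulr_ge0 ?sqr_ge0.
by rewrite ler_wpM2r// subr_ge0.
Qed.

(** With y = 1/x the three approximations lose the factors 1 - y (second summand
    of the first term of omega), 1 - 2 y (the power of x + 1) and 1 - 4 n y^3.
    When all are positive their product is at least 1 - 3 y - 4 n y^3;
    otherwise the envelope is nonpositive and the integrand is not. *)
Lemma coef_integrand_ge (n : nat) (x : R) : 1 <= x ->
  2 * pi ^+ 2 * (bessel_ker 0 pi (4 * n%:R) x - 3 * bessel_ker 1 pi (4 * n%:R) x
    - 4 * n%:R * bessel_ker 3 pi (4 * n%:R) x) <= coef_integrand (2 * n) x.
Proof.
move=> x1; have x0 : 0 < x by exact: lt_le_trans x1.
have pi0 := @pi_gt0 R; have pi2 := @pi_ge2 R.
have ho := omega_ge_first x1.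
have s0 : 0 < Num.sqrt x by rewrite sqrtr_gt0.
have x10 : 0 < x + 1 by rewrite addr_gt0.
have q0 : 0 <= (x - 1) / (x + 1) by rewrite divr_ge0 ?subr_ge0// ltW.
have ot0 : 0 <= omega_term x 1 by exact: omega_term_ge0.
set y := x^-1.
have y0 : 0 < y by rewrite invr_gt0.
have y1 : y <= 1 by rewrite invf_le1.
have xy : x * y = 1 by rewrite divff// gt_eqF.
set k := Num.sqrt x * expR (- (pi * x + 4 * n%:R / x)).
have k0 : 0 <= k by rewrite mulr_ge0 ?expR_ge0 ?ltW.
have -> : bessel_ker 0 pi (4 * n%:R) x - 3 * bessel_ker 1 pi (4 * n%:R) x
    - 4 * n%:R * bessel_ker 3 pi (4 * n%:R) x = k * (1 - 3 * y - 4 * n%:R * y ^+ 3).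
  by rewrite /bessel_ker /k -/y !expr0 expr1; move: (expR _) => e; ring.
have n0 : 0 <= n%:R :> R by [].
have m2 : 0 <= 2 * pi ^+ 2 :> R by rewrite mulr_ge0 ?sqr_ge0.
have [small|big] := leP (1 - 3 * y - 4 * n%:R * y ^+ 3) 0.
  apply: le_trans (coef_integrand_ge0 (2 * n) x1).
  exact: mulr_ge0_le0 m2 (mulr_ge0_le0 k0 small).
(* here 3 y < 1 and 4 n y^3 < 1, so every factor below is positive *)
have ny0 : 0 <= 4 * n%:R * y ^+ 3 by rewrite !mulr_ge0 ?exprn_ge0 ?(ltW y0).
have y30 : 0 <= y ^+ 3 by rewrite exprn_ge0 ?(ltW y0).
have y3 : y < 3^-1 by lra.
have y3y : y ^+ 3 <= y by rewrite exprS ler_piMr ?(ltW y0)// exprn_ile1 ?(ltW y0).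
have b0 : 0 <= 2 * y ^+ 3 by rewrite mulr_ge0.
have b1 : 2 * y ^+ 3 <= 1 by lra.
have q1 : (1 - 4 * n%:R * y ^+ 3) * expR (- (4 * n%:R / x)) <= ((x - 1) / (x + 1)) ^+ (2 * n).
  have := mobius_ge_expRN (ltW y0) y1.
  have -> : (1 - y) / (1 + y) = (x - 1) / (x + 1).
    have x1n : 1 + x != 0 by rewrite addrC gt_eqF.
    by rewrite /y; field; rewrite addrC x1n gt_eqF.
  move=> h; apply: (@le_trans _ _ (((1 - 2 * y ^+ 3) * expR (- (2 * y))) ^+ (2 * n))); last first.
    by apply: lerXn2r => //; rewrite nnegrE ?mulr_ge0 ?expR_ge0 ?subr_ge0.
  rewrite exprMn -expRM_natr.
  have -> : - (2 * y) * (2 * n)%:R = - (4 * n%:R / x) by rewrite natrM /y; ring.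
  rewrite ler_wpM2r ?expR_ge0//.
  have -> : 4 * n%:R * y ^+ 3 = (2 * n)%:R * (2 * y ^+ 3) by rewrite natrM; ring.
  exact: expr_onem_ge.
have p1 : (1 - 2 * y) / (x * Num.sqrt x) <= ((x + 1) `^ (3 / 2))^-1.
  have xs : Num.sqrt (x + 1) <= Num.sqrt x * (1 + y).
    rewrite -(@ger0_norm _ (_ * (1 + y))) ?mulr_ge0 ?addr_ge0 ?(ltW s0) ?(ltW y0)//.
    rewrite -sqrtr_sqr ler_sqrt ?sqr_ge0// exprMn sqr_sqrtr ?(ltW x0)//.
    rewrite -subr_ge0 (_ : _ - _ = (x * y - 1) + x * y + x * y ^+ 2); last by ring.
    have xy2 : 0 <= x * y ^+ 2 by rewrite mulr_ge0 ?sqr_ge0 ?(ltW x0).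
    by rewrite xy subrr add0r addr_ge0.
  have s10 : 0 < Num.sqrt (x + 1) by rewrite sqrtr_gt0.
  rewrite powR32// ler_pdivrMr ?mulr_gt0// [leRHS]mulrC ler_pdivlMr ?mulr_gt0//.
  apply: (@le_trans _ _ ((1 - 2 * y) * ((x + 1) * (Num.sqrt x * (1 + y))))).
    by rewrite ler_wpM2l ?ler_wpM2l ?(ltW x10)//; lra.
  have -> : (1 - 2 * y) * ((x + 1) * (Num.sqrt x * (1 + y))) =
    ((1 - 2 * y) * (1 + y) ^+ 2) * (x * Num.sqrt x).
    by rewrite /y; field; rewrite gt_eqF.
  rewrite ler_piMl ?mulr_ge0 ?(ltW s0) ?(ltW x0)//.
  rewrite -subr_ge0 (_ : _ - _ = y ^+ 2 * (3 + 2 * y)); last by ring.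
  by rewrite mulr_ge0 ?sqr_ge0// addr_ge0 ?mulr_ge0 ?(ltW y0).
have o1 : omega_term x 1 >= 2 * pi ^+ 2 * x ^+ 2 * (1 - y) * expR (- (pi * x)).
  rewrite /omega_term !expr1n !mulr1 ler_wpM2r ?expR_ge0// -subr_ge0.
  have -> : 2 * pi ^+ 2 * x ^+ 2 - 3 * pi * x - 2 * pi ^+ 2 * x ^+ 2 * (1 - y) =
    pi * x * (2 * pi * (x * y) - 3) by ring.
  rewrite xy mulr1 !mulr_ge0 ?(ltW pi0) ?(ltW x0)//; lra.
have m0 : 0 <= 2 * pi ^+ 2 * x ^+ 2 by rewrite !mulr_ge0 ?(ltW pi0) ?(ltW x0).
have o2 : 0 <= 2 * pi ^+ 2 * x ^+ 2 * (1 - y) * expR (- (pi * x)).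
  by apply: mulr_ge0 (expR_ge0 _); apply: (mulr_ge0 m0); rewrite subr_ge0.
have p0 : 0 <= (1 - 2 * y) / (x * Num.sqrt x).
  by rewrite divr_ge0 ?mulr_ge0 ?(ltW x0) ?(ltW s0)//; lra.
have q2 : 0 <= (1 - 4 * n%:R * y ^+ 3) * expR (- (4 * n%:R / x)).
  by rewrite mulr_ge0 ?expR_ge0//; lra.
apply: (@le_trans _ _ ((2 * pi ^+ 2 * x ^+ 2 * (1 - y) * expR (- (pi * x))) *
  ((1 - 2 * y) / (x * Num.sqrt x)) * ((1 - 4 * n%:R * y ^+ 3) * expR (- (4 * n%:R / x))))); last first.
  rewrite /coef_integrand ler_pM ?(mulr_ge0 o2)//.
  by rewrite ler_pM//; exact: le_trans ho.
have -> : (2 * pi ^+ 2 * x ^+ 2 * (1 - y) * expR (- (pi * x))) *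
  ((1 - 2 * y) / (x * Num.sqrt x)) * ((1 - 4 * n%:R * y ^+ 3) * expR (- (4 * n%:R / x))) =
  2 * pi ^+ 2 * k * ((1 - y) * (1 - 2 * y) * (1 - 4 * n%:R * y ^+ 3)).
  rewrite /k opprD expRD.
  have xx : x = Num.sqrt x ^+ 2 by rewrite sqr_sqrtr// ltW.
  have sx : x ^+ 2 / (x * Num.sqrt x) = Num.sqrt x.
    move: (Num.sqrt x) s0 xx => s s0 xx; rewrite xx; field; rewrite gt_eqF//.
  rewrite -[in RHS]sx.
  by ring.
rewrite mulrA ler_wpM2l ?(mulr_ge0 m2)//.
have a1 : 1 - 3 * y <= (1 - y) * (1 - 2 * y).
  rewrite -subr_ge0 (_ : _ - _ = 2 * y ^+ 2); last by ring.
  by rewrite mulr_ge0 ?sqr_ge0.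
apply: (@le_trans _ _ ((1 - 3 * y) * (1 - 4 * n%:R * y ^+ 3))); last first.
  by rewrite ler_wpM2r//; lra.
rewrite -subr_ge0 (_ : _ - _ = 3 * y * (4 * n%:R * y ^+ 3)); last by ring.
by rewrite mulr_ge0 ?mulr_ge0 ?(ltW y0).
Qed.

End Integrand.

(** * Asymptotics of the even coefficients *)

Section CoefficientAsymptotics.
Variable R : realType.
Notation mu := (@lebesgue_measure R).

Definition has_integral (f : R -> R) (v : R) :=
  mu.-integrable `]0, +oo[ (EFin \o f) /\ \int[mu]_(x in `]0, +oo[) f x = v.

Lemma has_integralD f g v w : has_integral f v -> has_integral g w ->
  has_integral (fun x => f x + g x) (v + w).
Proof.
move=> [i1 <-] [i2 <-]; split; last by rewrite RintegralD.
have -> : EFin \o (fun x => f x + g x) = (fun x => ((f x)%:E + (g x)%:E)%E) by apply/funext.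
exact: integrableD.
Qed.

Lemma has_integralZ c f v : has_integral f v -> has_integral (fun x => c * f x) (c * v).
Proof.
move=> [i1 <-]; split; last by rewrite RintegralZl.
have -> : EFin \o (fun x => c * f x) = (fun x => (c%:E * (f x)%:E)%E) by apply/funext.
exact: integrableZl.
Qed.

Lemma has_integralB f g v w : has_integral f v -> has_integral g w ->
  has_integral (fun x => f x - g x) (v - w).
Proof.
move=> hf hg; have := has_integralD hf (has_integralZ (-1) hg).
by rewrite mulN1r; under eq_fun do rewrite mulN1r.
Qed.

Lemma measurable_omega : measurable_fun (`]0, +oo[ : set R) (@omega R).
Proof.
apply: (@measurable_fun_cvg _ _ _ _ (fun n x => \sum_(m < n) omega_term x m.+1%:R)).
  move=> n; apply: measurable_funTS; apply: continuous_measurable_fun => x.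
  have c (u : R) : {for x, continuous (fun x => omega_term x u)}.
    by rewrite /omega_term; exact: is_derive_continuous.
  elim: n => [|n IH].
    by under eq_fun do rewrite big_ord0; exact: cvg_cst.
  under eq_fun do rewrite big_ord_recr /=.
  exact: cvgD IH (c n.+1%:R).
by move=> x; rewrite /= in_itv/= andbT => x0; exact: cvg_omega.
Qed.

Lemma measurable_coef_integrand n :
  measurable_fun (`]0, +oo[ : set R) (@coef_integrand R n).
Proof.
have mx (c : R) : measurable_fun (`]0, +oo[ : set R) (fun x => x + c).
  by apply: measurable_funTS; apply: measurable_funD.
have mp (p : R) : measurable_fun (`]0, +oo[ : set R) (fun x => (x + 1) `^ p).
  exact: (@measurableT_comp _ _ _ _ _ _ (@powR R ^~ p) _ _ (measurable_powR p) (mx 1)).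
apply: (@eq_measurable_fun _ _ _ _ _ (fun x : R => omega x * (x + 1) `^ (- (3 / 2)) *
   ((x - 1) * (x + 1) `^ (- 1)) ^+ n)).
  move=> x /set_mem; rewrite /= in_itv/= andbT => x0.
  by rewrite /coef_integrand powRN powR_inv1 ?addr_ge0 ?ltW.
apply: measurable_funM.
  by apply: measurable_funM; [exact: measurable_omega|exact: mp].
by apply: measurable_funX; apply: measurable_funM; [exact: mx|exact: mp].
Qed.

(** The factor 1 - 3/x - b/x^3 of the lower envelope is negative on ]0, 1], so
    adding the inverted envelope only weakens the bound on [1, +oo[. *)
Let lower_kernel (a b x : R) :=
  bessel_ker 0 a b x - 3 * bessel_ker 1 a b x - b * bessel_ker 3 a b x.

Let lower_kernel_le0 (a b x : R) : 0 <= b -> 0 < x -> x <= 1 -> lower_kernel a b x <= 0.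
Proof.
move=> b0 x0 x1; rewrite /lower_kernel /bessel_ker expr0 expr1 mulr1.
set e := expR _; have e0 : 0 < e by exact: expR_gt0.
have s0 : 0 < Num.sqrt x by rewrite sqrtr_gt0.
have y1 : 1 <= x^-1 by rewrite invf_ge1.
have -> : Num.sqrt x * e - 3 * (Num.sqrt x * x^-1 * e) - b * (Num.sqrt x * x^-1 ^+ 3 * e) =
  - (Num.sqrt x * e * (3 * x^-1 - 1 + b * x^-1 ^+ 3)) by ring.
rewrite oppr_le0 mulr_ge0 ?mulr_ge0 ?(ltW s0) ?(ltW e0)//.
have : 0 <= b * x^-1 ^+ 3 by rewrite mulr_ge0// exprn_ge0// invr_ge0 ltW.
lra.
Qed.

Let lower_kernel_inv (a b x : R) : 0 < x -> x^-1 ^+ 2 * lower_kernel a b x^-1 =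
  bessel_ker 3 b a x - 3 * bessel_ker 2 b a x - b * bessel_ker 0 b a x.
Proof.
move=> x0; rewrite /lower_kernel -(@bessel_ker_inv R 0 3 a b x x0 erefl).
rewrite -(@bessel_ker_inv R 1 2 a b x x0 erefl) -(@bessel_ker_inv R 3 0 a b x x0 erefl).
ring.
Qed.

(** The envelope for x >= 1 and its image under the inversion, added up. Each is
    nonnegative everywhere, so the sum is a bound on both sides of 1. *)
Lemma coef_integrand_le_total (S : R) (n : nat) (x : R) : 0 <= S ->
  (forall x : R, 1 <= x -> omega x <= 2 * pi ^+ 2 * x ^+ 2 * expR (- (pi * x))
    + S * x ^+ 2 * expR (- (2 * pi * x))) ->
  0 < x -> coef_integrand (2 * n) x <=
  2 * pi ^+ 2 * (bessel_ker 0 pi (4 * n%:R) x + bessel_ker 3 (4 * n%:R) pi x)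
  + S * (bessel_ker 0 (2 * pi) (4 * n%:R) x + bessel_ker 3 (4 * n%:R) (2 * pi) x).
Proof.
move=> S0 hS x0.
have K0 i a b : 0 <= bessel_ker i a b x by exact: bessel_ker_ge0.
have m2 : 0 <= 2 * pi ^+ 2 :> R by rewrite mulr_ge0 ?sqr_ge0.
rewrite (mulrDr (2 * pi ^+ 2)) (mulrDr S); have [x1|x1] := leP 1 x.
  apply: (le_trans (coef_integrand_le _ x1 (hS _ x1))).
  by apply: lerD; rewrite lerDl mulr_ge0.
have y1 : 1 <= x^-1 by rewrite invf_ge1// ltW.
rewrite coef_integrand_inv//.
apply: (@le_trans _ _ (x^-1 ^+ 2 * (2 * pi ^+ 2 * bessel_ker 0 pi (4 * n%:R) x^-1
    + S * bessel_ker 0 (2 * pi) (4 * n%:R) x^-1))).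
  by rewrite ler_wpM2l ?sqr_ge0//; exact: coef_integrand_le (hS _ y1).
rewrite (mulrDr (x^-1 ^+ 2)) (mulrCA _ (2 * pi ^+ 2)) (mulrCA _ S) !(@bessel_ker_inv _ 0 3)//.
by apply: lerD; rewrite lerDr mulr_ge0.
Qed.

Lemma coef_integrand_ge_total (n : nat) (x : R) : 0 < x ->
  2 * pi ^+ 2 * ((bessel_ker 0 pi (4 * n%:R) x - 3 * bessel_ker 1 pi (4 * n%:R) x
      - 4 * n%:R * bessel_ker 3 pi (4 * n%:R) x)
    + (bessel_ker 3 (4 * n%:R) pi x - 3 * bessel_ker 2 (4 * n%:R) pi x
      - 4 * n%:R * bessel_ker 0 (4 * n%:R) pi x))
  <= coef_integrand (2 * n) x.
Proof.
move=> x0; have n0 : 0 <= 4 * n%:R :> R by rewrite mulr_ge0.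
have m2 : 0 <= 2 * pi ^+ 2 :> R by rewrite mulr_ge0 ?sqr_ge0.
rewrite -lower_kernel_inv// mulrDr -/(lower_kernel pi (4 * n%:R) x).
have [x1|x1] := leP 1 x.
  apply: le_trans (coef_integrand_ge n x1).
  rewrite gerDl mulr_ge0_le0// mulr_ge0_le0 ?sqr_ge0// lower_kernel_le0 ?invr_gt0//.
  by rewrite invf_le1.
have y1 : 1 <= x^-1 by rewrite invf_ge1// ltW.
rewrite coef_integrand_inv//.
apply: (@le_trans _ _ (2 * pi ^+ 2 * (x^-1 ^+ 2 * lower_kernel pi (4 * n%:R) x^-1))).
  by rewrite gerDr mulr_ge0_le0// lower_kernel_le0// ltW.
by rewrite mulrCA ler_wpM2l ?sqr_ge0//; exact: coef_integrand_ge.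
Qed.

Lemma coef_integrand_ge0_total (n : nat) (x : R) : 0 < x -> 0 <= coef_integrand (2 * n) x.
Proof.
move=> x0; have [x1|x1] := leP 1 x; first exact: coef_integrand_ge0.
rewrite coef_integrand_inv// mulr_ge0 ?sqr_ge0// coef_integrand_ge0// invf_ge1// ltW//.
Qed.

Lemma integral_coef_integrand_bounds (f g : R -> R) (v w : R) (n : nat) :
  has_integral f v -> has_integral g w ->
  (forall x : R, 0 < x -> f x <= coef_integrand (2 * n) x) ->
  (forall x : R, 0 < x -> coef_integrand (2 * n) x <= g x) ->
  v <= \int[mu]_(x in `]0, +oo[) coef_integrand (2 * n) x /\
  \int[mu]_(x in `]0, +oo[) coef_integrand (2 * n) x <= w.
Proof.
move=> [fi <-] [gi <-] fW Wg.
have Wi : mu.-integrable `]0, +oo[ (EFin \o coef_integrand (2 * n)).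
  apply: le_integrable gi => //.
    by apply/measurable_EFinP; exact: measurable_coef_integrand.
  move=> x; rewrite /= in_itv/= andbT => x0; rewrite lee_fin.
  rewrite ger0_norm ?coef_integrand_ge0_total//.
  exact: le_trans (Wg _ x0) (ler_norm _).
split; apply: le_Rintegral => // x; rewrite /= in_itv/= andbT => x0.
  exact: fW.
exact: Wg.
Qed.

(** The elementary end of the argument, with p = sqrt pi, t = sqrt n,
    q = sqrt 2, r = sqrt (2 pi), E = e^(-4 sqrt (pi n)), and E' the exponential
    belonging to a = 2 pi, b = 4 n. The bounds on J are the
    integrals of the two envelopes as the closed forms deliver them. Both have
    leading term 8 p^3 t E; the other terms are smaller by a factor t at least,
    those with E' because t E' <= E. *)
Lemma sandwich_to_relative_error (p t q r E E' S J : R) :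
  1 <= p -> 1 <= t -> 0 <= q -> 1 <= r -> 0 < E -> 0 <= E' -> t * E' <= E -> 0 <= S ->
  2 * p ^+ 2 ^+ 2 *
  (p * E * ((2 * p)^-1 + 2 * t) / p ^+ 2 - 3 * (p * E / p) -
   4 * t ^+ 2 * (p * E * ((2 * (2 * t))^-1 + p) / (4 * t ^+ 2)) +
   (p * E * ((2 * p)^-1 + 2 * t) / p ^+ 2 - 3 * (p * E / p) -
    4 * t ^+ 2 * (p * E * ((2 * (2 * t))^-1 + p) / (4 * t ^+ 2)))) <= J ->
  J <= 2 * p ^+ 2 ^+ 2 *
  (p * E * ((2 * p)^-1 + 2 * t) / p ^+ 2 +
   p * E * ((2 * p)^-1 + 2 * t) / p ^+ 2) +
  S *
  (p * E' * ((2 * r)^-1 + 2 * t) / (2 * p ^+ 2) +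
   p * E' * ((2 * r)^-1 + 2 * t) / (2 * p ^+ 2)) ->
  `|2 * q * J - 16 * q * p ^+ 3 * t * E| <=
  (1 + S + p * (3 + p ^+ 2 + p)) / t * (16 * q * p ^+ 3 * t * E).
Proof.
move=> p1 t1 q0 r1 E0 E'0 E'E S0 lo up.
have p0 : 0 < p by exact: lt_le_trans p1.
have t0 : 0 < t by exact: lt_le_trans t1.
have r0 : 0 < r by exact: lt_le_trans r1.
have pE j : 0 <= p ^+ j * E by rewrite mulr_ge0 ?exprn_ge0 ?(ltW p0) ?(ltW E0).
have pS j : p ^+ j * E <= p ^+ j.+1 * E.
  by rewrite ler_wpM2r ?(ltW E0)//; exact: ler_weXn2l p1 _ _ (leqnSn j).
rewrite (_ : _ / t * _ = q * (16 * p ^+ 3 * E * (1 + S + p * (3 + p ^+ 2 + p)))); last first.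
  by field; rewrite gt_eqF.
rewrite (_ : _ - _ = q * (2 * J - 16 * p ^+ 3 * t * E)); last by ring.
rewrite normrM (ger0_norm q0) ler_wpM2l//.
have SE : 0 <= S * (p ^+ 3 * E) by rewrite mulr_ge0.
have S1 : S * E <= S * (p ^+ 3 * E).
  by rewrite ler_wpM2l// ler_peMl ?(ltW E0)// exprn_ege1.
rewrite (_ : 16 * p ^+ 3 * E * (1 + S + p * (3 + p ^+ 2 + p)) = 16 * (p ^+ 3 * E) + 16 * (S * (p ^+ 3 * E))
  + 48 * (p ^+ 4 * E) + 16 * (p ^+ 6 * E) + 16 * (p ^+ 5 * E)); last by ring.
rewrite ler_norml; apply/andP; split.
  move: lo; rewrite (_ : 2 * p ^+ 2 ^+ 2 * _ = 8 * (p ^+ 3 * t * E) + 2 * (p ^+ 2 * E)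
    - 12 * (p ^+ 4 * E) - t^-1 * (p ^+ 5 * E) - 4 * (p ^+ 6 * E)); last first.
    by field; rewrite !gt_eqF.
  have : t^-1 * (p ^+ 5 * E) <= p ^+ 5 * E by rewrite ler_piMl// invf_le1.
  have := pE 2%N; have := pE 3%N; have := pE 4%N; have := pE 5%N; have := pE 6%N.
  have -> : 16 * p ^+ 3 * t * E = 16 * (p ^+ 3 * t * E) by ring.
  move: SE; move: (S * (p ^+ 3 * E)) (t^-1 * (p ^+ 5 * E)) (p ^+ 3 * t * E)
    (p ^+ 2 * E) (p ^+ 3 * E) (p ^+ 4 * E) (p ^+ 5 * E) (p ^+ 6 * E).
  by move=> a1 a2 a3 a4 a5 a6 a7 a8; lra.
move: up; rewrite (_ : 2 * p ^+ 2 ^+ 2 * _ = 8 * (p ^+ 3 * t * E) + 2 * (p ^+ 2 * E)); last first.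
  by field; rewrite gt_eqF.
have : S * (p * E' * ((2 * r)^-1 + 2 * t) / (2 * p ^+ 2) +
    p * E' * ((2 * r)^-1 + 2 * t) / (2 * p ^+ 2)) <= 3 * (S * E).
  rewrite (_ : S * _ = p^-1 * (S * (((2 * r)^-1 + 2 * t) * E'))); last first.
    by field; rewrite !gt_eqF.
  apply: (@le_trans _ _ (S * (((2 * r)^-1 + 2 * t) * E'))).
    rewrite ler_piMl ?invf_le1// !mulr_ge0// addr_ge0 ?invr_ge0 ?mulr_ge0 ?(ltW r0) ?(ltW t0)//.
  rewrite (mulrCA 3) ler_wpM2l//; apply: (@le_trans _ _ (3 * t * E')).
    rewrite ler_wpM2r//.
    have : (2 * r)^-1 <= 1 by rewrite invf_le1 ?mulr_gt0//; lra.
    lra.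
  by rewrite -mulrA ler_wpM2l.
have := pE 3%N; have := pE 4%N; have := pE 5%N; have := pE 6%N; have := pS 2%N.
have -> : 16 * p ^+ 3 * t * E = 16 * (p ^+ 3 * t * E) by ring.
move: SE S1; move: (S * (p ^+ 3 * E)) (S * E) (S * (_ + _)) (p ^+ 3 * t * E)
  (p ^+ 2 * E) (p ^+ 3 * E) (p ^+ 4 * E) (p ^+ 5 * E) (p ^+ 6 * E).
by move=> a1 a2 a3 a4 a5 a6 a7 a8 a9; lra.
Qed.

Let main_term (n : nat) : R :=
  16 * Num.sqrt 2 * pi `^ (3 / 2) * Num.sqrt n%:R * expR (- (4 * Num.sqrt (pi * n%:R))).

Lemma coef_c_even_bound : exists K : R, 0 <= K /\ forall n : nat, (0 < n)%N ->
  0 < main_term n /\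
  `|coef_c R (2 * n) - main_term n| <= K / Num.sqrt n%:R * main_term n.
Proof.
have pi0 := @pi_gt0 R; have pi2 := @pi_ge2 R.
have [S [S0 hS]] := omega_le R.
set sp : R := Num.sqrt pi.
have sp1 : 1 <= sp by rewrite -sqrtr1 ler_sqrt; lra.
have spE : pi = sp ^+ 2 by rewrite sqr_sqrtr// ltW.
pose K := 1 + S + sp * (3 + sp ^+ 2 + sp).
have K0 : 0 <= K.
  by rewrite !addr_ge0// mulr_ge0 ?addr_ge0 ?sqr_ge0//; lra.
exists K; split => // n n0.
have nR : 0 < n%:R :> R by rewrite ltr0n.
set b : R := 4 * n%:R.
have b0 : 0 < b by rewrite mulr_gt0.
have p20 : 0 < 2 * pi :> R by rewrite mulr_gt0.
set sn : R := Num.sqrt n%:R.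
have sn1 : 1 <= sn by rewrite -sqrtr1 ler_sqrt// ler1n.
have snE : n%:R = sn ^+ 2 by rewrite sqr_sqrtr// ltW.
have sb : Num.sqrt b = 2 * sn.
  rewrite sqrtrM// (_ : 4 = 2 ^+ 2); last by ring.
  by rewrite sqrtr_sqr ger0_norm.
set s2p : R := Num.sqrt (2 * pi).
have s2pE : s2p = Num.sqrt 2 * sp by rewrite /s2p sqrtrM.
set E := expR (- (4 * (sp * sn))).
have E0 : 0 < E by exact: expR_gt0.
set q : R := Num.sqrt 2.
have q54 : 5 / 4 <= q.
  rewrite -[leLHS]ger0_norm ?divr_ge0// -sqrtr_sqr ler_sqrt//; lra.
have ME : main_term n = 16 * q * sp ^+ 3 * sn * E.
  rewrite /main_term powR32// sqrtrM ?(ltW pi0)// -/sp -/sn -/q -/E.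
  by rewrite {1}spE; ring.
have M0 : 0 < main_term n.
  by rewrite ME !mulr_gt0 ?exprn_gt0//; lra.
split => //.
(* the second exponential decays faster by e^(- 4 (sqrt (2 pi) - sqrt pi) sqrt n),
   which beats the factor sqrt n *)
have gap : 1 <= 4 * (s2p - sp).
  rewrite s2pE -/q; move: (q) (sp) q54 sp1 => r t r54 t1.
  have : 5 / 4 * t <= r * t by rewrite ler_wpM2r//; lra.
  lra.
have s2p1 : 1 <= s2p by clear -gap sp1; lra.
have sn0 : 0 <= sn by apply: le_trans sn1.
set E' := expR (- (2 * (s2p * (2 * sn)))).
have E'0 : 0 <= E' by exact: expR_ge0.
have E'E : sn * E' <= E.
  have -> : E' = E * expR (- (4 * (s2p - sp) * sn)) by rewrite -expRD; congr expR; ring.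
  rewrite mulrCA ler_piMr ?(ltW E0)//.
  apply: (@le_trans _ _ (sn * expR (- sn))).
    by rewrite ler_wpM2l// ler_expR lerN2 ler_peMl.
  rewrite expRN ler_pdivrMr ?expR_gt0// mul1r.
  by apply: le_trans (expR_ge1Dx _); rewrite lerDr.
have h0 := bessel_ker0_integral pi0 b0.
have h1 := bessel_ker1_integral pi0 b0.
have h3 := bessel_ker3_integral pi0 b0.
have k0 := bessel_ker0_integral b0 pi0.
have k2 := bessel_ker2_integral b0 pi0.
have k3 := bessel_ker3_integral b0 pi0.
have g0 := bessel_ker0_integral p20 b0.
have g3 := bessel_ker3_integral b0 p20.
have lo := has_integralZ (2 * pi ^+ 2) (has_integralD
  (has_integralB (has_integralB h0 (has_integralZ 3 h1)) (has_integralZ b h3))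
  (has_integralB (has_integralB k3 (has_integralZ 3 k2)) (has_integralZ b k0))).
have up := has_integralD
  (has_integralZ (2 * pi ^+ 2) (has_integralD h0 k3))
  (has_integralZ S (has_integralD g0 g3)).
have [Jlo Jup] := integral_coef_integrand_bounds lo up
  (fun x x0 => coef_integrand_ge_total n x0)
  (fun x x0 => coef_integrand_le_total n S0 hS x0).
have -> : coef_c R (2 * n) = 2 * q * \int[mu]_(x in `]0, +oo[) coef_integrand (2 * n) x by [].
set J := \int[mu]_(x in _) _ in Jlo Jup *.
have eE1 : 2 * (sp * (2 * sn)) = 4 * (sp * sn) by ring.
have eE2 : 2 * (2 * sn * sp) = 4 * (sp * sn) by ring.
have eE3 : 2 * (2 * sn * s2p) = 2 * (s2p * (2 * sn)) by ring.
rewrite !sb -!/sp -!/s2p !eE1 !eE2 !eE3 -!/E -!/E' in Jlo Jup.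
have bE : b = 4 * sn ^+ 2 by rewrite /b snE.
rewrite ME; move: Jlo Jup; rewrite bE spE => Jlo Jup.
exact: (sandwich_to_relative_error sp1 sn1 (sqrtr_ge0 2) s2p1 E0 E'0 E'E S0 Jlo Jup).
Qed.

End CoefficientAsymptotics.

Theorem theorem3p2 (R : realType) :
  exists e : nat -> R,
    e =O_\oo (fun n : nat => n%:R `^ (- (1 / 10)) : R) /\
    \forall n \near \oo,
      coef_c R (2 * n) =
        (1 + e n) *
        (16 * Num.sqrt 2 * pi `^ (3 / 2) * Num.sqrt n%:R
          * expR (- (4 * Num.sqrt (pi * n%:R)))).
Proof.
have [K [K0 hK]] := coef_c_even_bound R.
pose M (n : nat) : R := 16 * Num.sqrt 2 * pi `^ (3 / 2) * Num.sqrt n%:R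
  * expR (- (4 * Num.sqrt (pi * n%:R))).
exists (fun n => coef_c R (2 * n) / M n - 1); split; last first.
  near=> n.
  have n0 : (0 < n)%N by near: n; exact: nbhs_infty_gt.
  have [M0 _] := hK n n0.
  by rewrite addrC subrK -/(M n) divfK// gt_eqF.
(* the error is at most K n^(-1/2), hence K n^(-1/10) *)
apply/eqOP; near=> k.
have kK : K <= k by near: k; exact: (nbhs_pinfty_ge (num_real K)).
near=> n.
have n0 : (0 < n)%N by near: n; exact: nbhs_infty_gt.
have nR : 0 < n%:R :> R by rewrite ltr0n.
have [M0 h] := hK n n0; rewrite -/(M n) in M0 h.
rewrite (ger0_norm (powR_ge0 _ _)).
have -> : coef_c R (2 * n) / M n - 1 = (coef_c R (2 * n) - M n) / M n.
  by rewrite mulrBl divff ?gt_eqF.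
rewrite normrM normfV (gtr0_norm M0) ler_pdivrMr//.
apply: (le_trans h); rewrite ler_wpM2r ?(ltW M0)//.
apply: ler_pM => //.
rewrite -powR12_sqrt ?(ltW nR)// -powRN.
by apply: ler_powR; [rewrite ler1n|lra].
Unshelve. all: by end_near. Qed.
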